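(* Let $(x_s)_{s\in S}$ be a normalized family in a Banach space $X$ (i.e. $\|x_s\|=1$ for all $s\in S$). Assume that for every chain $\beta\in\mathcal{C}(S)$, the sequence $(x_s)_{s\in\beta}$ is weakly null. Then there exists a subtree $T$ of $S$ such that either (1) for every chain $\beta\in\mathcal{C}(T)$, the sequence $(x_s)_{s\in\beta}$ is semi-boundedly complete; or (2) there is a constant $C>0$ such that for every chain $\beta\in\mathcal{C}(T)$, the sequence $(x_s)_{s\in\beta}$ is $C$-equivalent to the unit vector basis of $c_0$.
   Context: $S=\bigcup_{n=0}^\infty\{0,1\}^n$ is the dyadic tree of all finite sequences in $\{0,1\}$ (including the empty one), partially ordered by the initial segment relation $\le$. A subtree of $S$ is a subset $T\subseteq S$, with the induced order, which has a single minimal element and in which every element has exactly two immediate successors (i.e. for each $t\in T$ there are exactly two minimal elements of $\{t'\in T: t<t'\}$); thus $T$ is order isomorphic to $S$. A chain of a tree $T$ is an infinite linearly ordered subset of $T$; $\mathcal{C}(T)$ is the set of all chains of $T$. For a chain $\beta$ with elements enumerated increasingly as $s_1<s_2<\cdots$, $(x_s)_{s\in\beta}$ denotes the sequence $(x_{s_i})_{i=1}^\infty$. A normalized sequence $(e_i)$ is semi-boundedly complete if it is a Schauder basic sequence and for every $(\lambda_i)\in\mathbb{R}^{\mathbb{N}}$, $\sup_n\|\sum_{i=1}^n\lambda_ie_i\|<+\infty$ implies $\lim_{n\to\infty}\lambda_n=0$. A sequence $(y_i)$ is $C$-equivalent to the unit vector basis of $c_0$ if for every $n\in\mathbb{N}$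 and all $a_1,\ldots,a_n\in\mathbb{R}$, $\frac1C\max_{i\le n}|a_i|\le\|\sum_{i=1}^na_iy_i\|\le C\max_{i\le n}|a_i|$. *)

(* Defs.v *)
From mathcomp Require Import all_boot all_order all_algebra.
From mathcomp Require Import all_classical all_reals all_analysis.
Import Order.TTheory GRing.Theory Num.Theory.
Import numFieldNormedType.Exports.

Set Implicit Arguments.
Unset Strict Implicit.
Unset Printing Implicit Defensive.

Local Open Scope classical_set_scope.
Local Open Scope ring_scope.

Notation dyadic := (seq bool).

Definition dle (s t : dyadic) : Prop := prefix s t.

Definition dlt (s t : dyadic) : Prop := dle s t /\ s <> t.

Definition minimals (A : set dyadic) : set dyadic :=
  [set t | A t /\ forall s, A s -> dle s t -> s = t].

Definition immediate_successors (T : set dyadic) (t : dyadic) : set dyadic :=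
  minimals [set s | T s /\ dlt t s].

Definition is_subtree (T : set dyadic) : Prop :=
  (exists r, minimals T = [set r]) /\
  (forall t, T t ->
     exists u v, u <> v /\ immediate_successors T t = [set u; v]).

Definition is_chain (T beta : set dyadic) : Prop :=
  [/\ beta `<=` T, infinite_set beta & total_on beta dle].

Definition enumerates (beta : set dyadic) (e : nat -> dyadic) : Prop :=
  (forall i, dlt (e i) (e i.+1)) /\ range e = beta.

(* The value is arbitrary when beta has no increasing enumeration; see
   chain_enumP and enumerates_inj for chains. *)
Definition chain_enum (beta : set dyadic) : nat -> dyadic :=
  xget (fun=> [::]) [set e | enumerates beta e].

Definition along (X : Type) (x : dyadic -> X) (beta : set dyadic) : nat -> X :=
  fun i => x (chain_enum beta i).

Lemma dlt_size s t : dlt s t -> (size s < size t)%N.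
Proof.
move=> [/prefixP[u ->]]; case: u => [|b u]; first by rewrite cats0.
by move=> _; rewrite size_cat /= addnS ltnS leq_addr.
Qed.

Lemma dle_size s t : dle s t -> (size s <= size t)%N.
Proof. by move=> /prefixP[u ->]; rewrite size_cat leq_addr. Qed.

Lemma dle_size_eq s t : dle s t -> size s = size t -> s = t.
Proof.
by move=> st eqs; case: (eqVneq s t) => // /eqP nst;
   have := dlt_size (conj st nst); rewrite eqs ltnn.
Qed.

Lemma ex_min_size (A : set dyadic) : A !=set0 ->
  exists2 m, A m & forall t, A t -> (size m <= size t)%N.
Proof.
move=> [a Aa].
have ex : exists n, `[< exists2 t, A t & size t = n >].
  by exists (size a); apply/asboolP; exists a.
case: (ex_minnP ex) => n /asboolP[m Am <-] mP.
by exists m => // t At; apply: mP; apply/asboolP; exists t.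
Qed.

Lemma enumerates_ltn_size beta e : enumerates beta e ->
  {homo e : i j / (i < j)%N >-> (size i < size j)%N}.
Proof.
move=> [inc _]; apply: homo_ltn => [y x z|i]; first exact: ltn_trans.
exact: dlt_size.
Qed.

Lemma chain_size_inj T beta s t : is_chain T beta ->
  beta s -> beta t -> size s = size t -> s = t.
Proof.
move=> [_ _ tot] bs bt eqs; case: (tot _ _ bs bt) => h.
  exact: dle_size_eq.
by apply/esym; apply: dle_size_eq.
Qed.

Lemma chain_lt T beta s t : is_chain T beta ->
  beta s -> beta t -> (size s < size t)%N -> dlt s t.
Proof.
move=> [_ _ tot] bs bt lst; split; last by move=> st; rewrite st ltnn in lst.
by case: (tot _ _ bs bt) => // /dle_size; rewrite leqNgt lst.
Qed.

Lemma chain_enum_exists T beta : is_chain T beta -> exists e, enumerates beta e.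
Proof.
move=> cb; have [_ infb _] := cb.
have nxt s : exists m, beta s ->
    [/\ beta m, (size s < size m)%N &
      forall t, beta t -> (size s < size t)%N -> (size m <= size t)%N].
  case: (pselect (beta s)) => [bs|]; last by exists s.
  have [|m [bm sm] mP] := @ex_min_size [set t | beta t /\ (size s < size t)%N].
    apply: contrapT => /set0P/negP/negPn/eqP h; apply: infb.
    apply: (@sub_finite_set _ _ [set` [seq take n s | n <- iota 0 (size s).+1]]);
      last exact: finite_seq.
    move=> t bt.
    have ts : (size t <= size s)%N.
      rewrite leqNgt; apply/negP => st.
      by have : [set t | beta t /\ (size s < size t)%N] t by []; rewrite h.
    have : dle t s.
      have [_ _ tot] := cb; case: (tot _ _ bt bs) => // st.
      have -> : s = t; last exact: prefix_refl.
      by apply: (dle_size_eq st); apply/eqP; rewrite eqn_leq ts dle_size.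
    rewrite /dle prefixE => /eqP tE; rewrite mksetE -[X in X \in _]tE.
    apply: (map_f (fun n => take n s)).
    by rewrite mem_iota add0n ltnS.
  by exists m => _; split=> // t bt st; apply: mP.
have [f fP] := choice nxt.
have [m0 bm0 m0P] : exists2 m, beta m & forall t, beta t -> (size m <= size t)%N.
  apply: ex_min_size; apply/set0P/eqP => b0.
  by apply: infb; rewrite b0.
pose e i := iter i f m0.
have be i : beta (e i) by elim: i => //= i /fP[].
have eS i : (size (e i) < size (e i.+1))%N by have [] := fP _ (be i).
have ei i : (i <= size (e i))%N.
  by elim: i => // i IH; apply: leq_ltn_trans (eS i).
exists e; split; first by move=> i; apply: (chain_lt cb).
apply/seteqP; split=> [_ [i _ <-] //|t bt].
have ex : exists n, (size t < size (e n))%N.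
  by exists (size t).+1; apply: ei.
case: (ex_minnP ex) => -[|n] tn nP; first by rewrite ltnNge m0P in tn.
exists n => //; apply: (chain_size_inj cb) => //; apply/eqP.
rewrite eqn_leq; apply/andP; split.
  rewrite leqNgt; apply/negP => h; first by have := nP _ h; rewrite ltnn.
rewrite leqNgt; apply/negP => h.
have [_ _ /(_ _ bt h)] := fP _ (be n).
by rewrite leqNgt tn.
Qed.

Lemma chain_enumP T beta : is_chain T beta -> enumerates beta (chain_enum beta).
Proof. by move=> /chain_enum_exists[e eP]; apply: (xgetPex _ (ex_intro _ e eP)). Qed.

Lemma enumerates_inj beta e e' : enumerates beta e -> enumerates beta e' -> e = e'.
Proof.
have half (a b : nat -> dyadic) : enumerates beta a -> enumerates beta b ->
    exists k : nat -> nat, forall i, b i = a (k i) /\ (i <= k i)%N.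
  move=> aP bP.
  have ex i : exists k, b i = a k.
    have [k _ <-] : range a (b i) by rewrite (proj2 aP) -(proj2 bP); exists i.
    by exists k.
  have [k kP] := choice ex; exists k => i; split=> //.
  elim: i => // i IH; apply: leq_ltn_trans IH _; rewrite ltnNge; apply/negP => h.
  have := enumerates_ltn_size bP (ltnSn i); rewrite !kP ltnNge => /negP; apply.
  move: h; rewrite leq_eqVlt => /orP[/eqP -> //|h].
  by apply/ltnW/(enumerates_ltn_size aP).
have le (a : nat -> dyadic) i j : enumerates beta a -> (i <= j)%N ->
    (size (a i) <= size (a j))%N.
  move=> aP; rewrite leq_eqVlt => /orP[/eqP -> //|h].
  by apply/ltnW/(enumerates_ltn_size aP).
move=> eP eP'; apply/funext => i.
have [k kP] := half _ _ eP eP'; have [k' kP'] := half _ _ eP' eP.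
have [ki lki] := kP i; have [ki' lki'] := kP' i.
rewrite ki; congr e; apply/eqP; rewrite eqn_leq lki /= leqNgt; apply/negP => h.
have := enumerates_ltn_size eP h; rewrite -ki ltnNge => /negP; apply.
by rewrite ki'; apply: le.
Qed.

Section banach.
Context {R : realType} {X : completeNormedModType R}.

Definition weakly_null (u : nat -> X) : Prop :=
  forall f : {linear X -> R^o}, continuous f -> f (u n) @[n --> \oo] --> (0 : R^o).

Definition expansion (u : nat -> X) (a : nat -> R) (y : X) : Prop :=
  series (fun n => a n *: u n) @ \oo --> y.

Definition closed_span (u : nat -> X) : set X :=
  closure [set y | exists (n : nat) (a : nat -> R), y = \sum_(i < n) a i *: u i].

(* u is a Schauder basis of its closed linear span. *)
Definition schauder_basic (u : nat -> X) : Prop :=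
  forall y, closed_span u y -> exists! a : nat -> R, expansion u a y.

Definition semi_boundedly_complete (u : nat -> X) : Prop :=
  [/\ forall n, `|u n| = 1,
      schauder_basic u &
      forall lambda : nat -> R,
        has_ubound (range (fun n => `|\sum_(i < n) lambda i *: u i|)) ->
        lambda n @[n --> \oo] --> (0 : R)].

Definition equiv_c0 (C : R) (u : nat -> X) : Prop :=
  forall (n : nat) (a : 'I_n -> R),
    C^-1 * (\big[Num.max/0]_(i < n) `|a i|) <= `|\sum_(i < n) a i *: u i| /\
    `|\sum_(i < n) a i *: u i| <= C * (\big[Num.max/0]_(i < n) `|a i|).

End banach.

(* Main.v *)
Require Import Defs.
From HB Require Import structures.
From mathcomp Require Import all_boot all_order all_algebra.
From mathcomp Require Import all_classical all_reals all_analysis.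
From mathcomp Require Import lra.
Import Order.TTheory GRing.Theory Num.Theory.
Import numFieldNormedType.Exports.

Set Implicit Arguments.
Unset Strict Implicit.
Unset Printing Implicit Defensive.

Local Open Scope classical_set_scope.
Local Open Scope ring_scope.

(** A perfect subset of the dyadic tree (every element has two incomparable
    extensions in the set) contains a subtree, and a two-coloured perfect set
    has a monochromatic perfect subset. Since an element of the tree has only
    finitely many predecessors, countably many such refinements, indexed by the
    finite chains, can be fused into a single subtree; accepting and rejecting
    finite chains then gives a Nash-Williams dichotomy for chains.

    Mazur's construction of basic sequences is such a fusion, and makes every
    chain basic. If for some K a perfect set has no finite chain with a signed
    (or smaller) combination of norm above K, its chains are uniformly
    equivalent to the basis of c_0. Otherwise one passes to a perfect set all
    of whose chains contain such combinations for every K, and then, following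
    Elton, to one where functionals of norm at most 1 can be chosen large on a
    prescribed part of a chain while staying small on the rest: if this failed,
    the Nash-Williams dichotomy would produce functionals bounded below on
    longer and longer pieces of one chain, contradicting weak nullity through
    the weak-star compactness of the dual ball. Evaluating such functionals on
    a bounded series whose coefficients are at least delta infinitely often
    contradicts its boundedness. *)

(** * Perfect sets and chains *)

Definition ltd (s t : dyadic) : bool := prefix s t && (s != t).

Definition incr (e : nat -> dyadic) := forall i, ltd (e i) (e i.+1).

Definition incomparable (s t : dyadic) : bool := ~~ (prefix s t || prefix t s).

Definition perfect (P : set dyadic) : Prop :=
  P !=set0 /\ forall t, P t -> exists u v,
    [/\ P u, P v, ltd t u, ltd t v & incomparable u v].

Definition above (P : set dyadic) (c : seq dyadic) : set dyadic :=
  [set u | P u /\ {in c, forall s, ltd s u}].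

Lemma ltdP s t : reflect (dlt s t) (ltd s t).
Proof.
apply: (iffP andP) => [[st /eqP nst]|[st nst]]; first by [].
by split=> //; apply/eqP.
Qed.

Lemma ltd_trans : transitive ltd.
Proof.
move=> t s u /andP[st nst] /andP[tu ntu]; rewrite /ltd (prefix_trans st tu) /=.
apply/eqP => su; case/eqP: ntu; rewrite -su in tu *.
by apply: dle_size_eq => //; apply/eqP; rewrite eqn_leq !dle_size.
Qed.

Lemma prefix_ltd_trans s t u : prefix s t -> ltd t u -> ltd s u.
Proof. by have [->//|nst] := eqVneq s t => st; apply: ltd_trans; apply/andP. Qed.

Lemma ltdW s t : ltd s t -> prefix s t. Proof. by case/andP. Qed.

Lemma ltdxx s : ltd s s = false. Proof. by rewrite /ltd eqxx andbF. Qed.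

Lemma prefix_comparable (s t u : dyadic) :
  prefix s u -> prefix t u -> prefix s t || prefix t s.
Proof.
elim: s t u => [|a s IH] [|b t] [|c u] //=.
by move=> /andP[/eqP -> su] /andP[/eqP -> tu]; rewrite eqxx; exact: IH su tu.
Qed.

Lemma incomparable_ext (s t s' t' : dyadic) : prefix s s' -> prefix t t' ->
  incomparable s t -> incomparable s' t'.
Proof.
move=> ss tt; apply: contra => /orP[h|h].
  exact: prefix_comparable (prefix_trans ss h) tt.
exact: prefix_comparable ss (prefix_trans tt h).
Qed.

(** Either some [w] in [P] has no strict extension in [P] that lies in [C], and the part of [P]
    above [w] avoids [C]; or [C] is cofinal in [P], and two incomparable extensions can be pushed up
    into [C], where they remain incomparable. *)
Lemma perfect_split (P C : set dyadic) : perfect P ->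
  exists Q, [/\ perfect Q, Q `<=` P & Q `<=` C \/ Q `<=` ~` C].
Proof.
move=> [[p Pp] Pbr].
have [[w [Pw wC]]|noC] :=
  pselect (exists w, P w /\ forall u, P u -> ltd w u -> ~ C u).
  exists [set u | P u /\ ltd w u]; split.
  - split; first by have [u [v [Pu _ wu _ _]]] := Pbr _ Pw; exists u.
    move=> t [Pt wt]; have [u [v [Pu Pv tu tv uv]]] := Pbr _ Pt.
    by exists u, v; split=> //; split=> //; apply: ltd_trans wt _.
  - by move=> u [].
  - by right=> u [Pu wu]; apply: wC.
have exC w : P w -> exists u, [/\ P u, ltd w u & C u].
  move=> Pw; apply: contrapT => h; apply: noC; exists w; split=> // u Pu wu Cu.
  by apply: h; exists u.
exists (P `&` C); split; [|exact: subIsetl|by left; exact: subIsetr].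
split; first by have [u [Pu _ Cu]] := exC _ Pp; exists u.
move=> t [Pt _]; have [u [v [Pu Pv tu tv uv]]] := Pbr _ Pt.
have [u' [Pu' uu' Cu']] := exC _ Pu; have [v' [Pv' vv' Cv']] := exC _ Pv.
exists u', v'; split=> //; [exact: ltd_trans uu'|exact: ltd_trans vv'|].
exact: incomparable_ext (ltdW uu') (ltdW vv') uv.
Qed.

Lemma sorted_rcons_ltd c t : sorted ltd (rcons c t) -> {in c, forall s, ltd s t}.
Proof.
rewrite -cats1 (sorted_pairwise ltd_trans) pairwise_cat allrel1r.
by move=> /= /andP[/allP h _].
Qed.

Lemma perfect_above P c : perfect P -> sorted ltd c -> {in c, forall s, P s} ->
  perfect (above P c).
Proof.
move=> [[p Pp] Pbr] sc cP.
have [t [Pt tP]] : exists t, P t /\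
    forall u, P u -> ltd t u -> above P c u.
  case/lastP: c sc cP => [|c t] sc cP; first by exists p.
  exists t; split=> [|u Pu tu]; first by apply: (cP t); rewrite mem_rcons inE eqxx.
  split=> // s; rewrite mem_rcons inE => /predU1P[-> //|sc'].
  exact: ltd_trans (sorted_rcons_ltd sc sc') tu.
split; first by have [u [v [Pu _ tu _ _]]] := Pbr _ Pt; exists u; apply: tP.
move=> s [Ps cs]; have [u [v [Pu Pv su sv uv]]] := Pbr _ Ps.
by exists u, v; split=> //; split=> // r rc; apply: (ltd_trans (cs _ rc)).
Qed.

Lemma perfect_chain P : perfect P -> exists e, incr e /\ forall i, P (e i).
Proof.
move=> [[p Pp] Pbr].
have nxt t : exists u, P t -> P u /\ ltd t u.
  have [/Pbr[u [v [Pu _ tu _ _]]]|] := pselect (P t); last by exists t.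
  by exists u.
have [f fP] := choice nxt.
have Pe i : P (iter i f p) by elim: i => //= i /fP[].
by exists (fun i => iter i f p); split=> // i; have [] := fP _ (Pe i).
Qed.

(** * Fusion of countably many dense requirements into one subtree *)

Fixpoint words (A : Type) (l : seq A) (n : nat) : seq (seq A) :=
  if n is n'.+1 then [::] :: [seq a :: c | a <- l, c <- words l n'] else [:: [::]].

Lemma mem_words (A : eqType) (l : seq A) n c :
  (size c <= n)%N -> {subset c <= l} -> c \in words l n.
Proof.
elim: n c => [|n IH] [|a c] //= cn cl; rewrite inE /=.
apply: allpairs_f; first by apply: cl; rewrite inE eqxx.
by apply: IH => // b bc; apply: cl; rewrite inE bc orbT.
Qed.

Section fusion.
Context {M : finType}.

(** Such a chain consists of distinct prefixes of [t], so its length is bounded, and it has finitely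
    many markings. This finiteness lets a node settle all requirements below it at once. *)
Lemma marked_chains_finite (t : dyadic) : exists L : seq (seq (dyadic * M)),
  forall c, sorted ltd (map fst c) -> {in map fst c, forall s, prefix s t} -> c \in L.
Proof.
pose prefixes := [seq take i t | i <- iota 0 (size t).+1].
exists (words [seq (s, m) | s <- prefixes, m <- enum M] (size t).+1) => c sc ct.
have cp : {subset map fst c <= prefixes}.
  move=> s /ct st; move: (st); rewrite prefixE => /eqP <-.
  by apply: (map_f (take^~ t)); rewrite mem_iota /= add0n ltnS; exact: dle_size.
apply: mem_words => [|[s m] sm].
  rewrite -(size_map fst) (leq_trans (uniq_leq_size _ cp)) ?size_map ?size_iota //.
  exact: sorted_uniq ltd_trans ltdxx _ sc.
apply: (allpairs_f (fun s m => (s, m))); last exact: mem_enum.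
exact/cp/(map_f fst sm).
Qed.

Variable D : seq (dyadic * M) -> set dyadic -> Prop.
Hypothesis D_sub : forall c P Q, Q `<=` P -> D c P -> D c Q.
Hypothesis D_dense : forall c P, perfect P -> exists Q, [/\ perfect Q, Q `<=` P & D c Q].

Lemma dense_seq (L : seq (seq (dyadic * M))) P : perfect P ->
  exists Q, [/\ perfect Q, Q `<=` P & {in L, forall c, D c Q}].
Proof.
elim: L P => [|c L IH] P pP; first by exists P; split=> // c; rewrite in_nil.
have [Q [pQ QP DQ]] := D_dense c pP; have [Q' [pQ' QQ' DQ']] := IH _ pQ.
exists Q'; split=> //; first exact: subset_trans QP.
by move=> d; rewrite inE => /predU1P[->|/DQ' //]; apply: D_sub DQ.
Qed.

(** A stage of the fusion: a node with a reservoir from which everything above the node is picked,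
    and which already meets the requirements of all chains of prefixes of the node. *)
Let good (p : dyadic * set dyadic) : Prop :=
  [/\ perfect p.2, forall u, p.2 u -> ltd p.1 u &
    forall c, sorted ltd (map fst c) -> {in map fst c, forall s, prefix s p.1} ->
      D c p.2].

Let good_exists t P : perfect P -> P t -> exists2 Q, Q `<=` P & good (t, Q).
Proof.
move=> pP Pt; have [L LP] := marked_chains_finite t.
have pa : perfect (above P [:: t]).
  by apply: perfect_above => // s; rewrite inE => /eqP ->.
have [Q [pQ QP DQ]] := dense_seq L pa.
exists Q; first by move=> u /QP[].
split=> // [u /QP[_ ]|c sc ct]; first by apply; rewrite inE.
exact/DQ/LP.
Qed.

Let children_exist p : exists q : bool -> dyadic * set dyadic, good p ->
  (forall b, [/\ good (q b), p.2 (q b).1 & (q b).2 `<=` p.2]) /\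
  incomparable (q false).1 (q true).1.
Proof.
have [gp|] := pselect (good p); last by exists (fun=> p).
have [[[r Pr] br] _ _] := gp.
have [u [v [Pu Pv _ _ uv]]] := br _ Pr.
have [U UP gU] := good_exists (conj (ex_intro _ r Pr) br) Pu.
have [V VP gV] := good_exists (conj (ex_intro _ r Pr) br) Pv.
by exists (fun b => if b then (v, V) else (u, U)) => _; split=> // -[].
Qed.

(** Following the choice function [F] along a binary word [w] yields a node [tau w] and a reservoir.
    A nonempty chain of nodes is settled by the reservoir of its last node, which contains all nodes
    above that one. *)
Lemma fusion P : perfect P -> exists T,
  [/\ is_subtree T, perfect T, T `<=` P &
    forall c, sorted ltd (map fst c) -> {in map fst c, forall s, T s} ->
      D c (above T (map fst c))].
Proof.
(* The empty chain has no last node to settle it, so its requirement is met beforehand. *)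
move=> pP; have [P0 [pP0 P0P DP0]] := D_dense [::] pP.
have [[r P0r] _] := pP0; have [Q0 Q0P g0] := good_exists pP0 P0r.
have [F FP] := choice children_exist.
have ext s p : good p -> let q := foldl F p s in
    [/\ good q, q.2 `<=` p.2, prefix p.1 q.1 & s != [::] -> p.2 q.1].
  elim: s p => [|b s IH] p gp /=; first by split=> //; exact: prefix_refl.
  have [/(_ b)[gb pb bp] _] := FP _ gp; have [gq qb bq sq] := IH _ gb.
  have lt_b : ltd p.1 (F p b).1 by have [_ + _] := gp; apply.
  split=> //; first exact: subset_trans bp.
    by apply: prefix_trans bq; apply: ltdW.
  by move=> _; case: s {IH gq qb bq} sq => [//|c s] sq; apply/bp/sq.
(* Incomparable words part at their first difference, where the two children were chosen
   incomparable. *)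
have inc w w' p : good p -> incomparable w w' ->
    incomparable (foldl F p w).1 (foldl F p w').1.
  elim: w w' p => [|a w IH] [|b w'] p gp //; rewrite /incomparable /=.
  have [child ab] := FP _ gp.
  have [<-|nab] := eqVneq a b; first by rewrite /=; apply: IH; case: (child a).
  move=> _; have [ga _ _] := child a; have [gb _ _] := child b.
  have [_ _ aw _] := ext w _ ga; have [_ _ bw _] := ext w' _ gb.
  apply: incomparable_ext aw bw _.
  by case: a b nab {IH ga gb} => -[] // _; rewrite /incomparable orbC.
pose phi := foldl F (r, Q0); pose tau w := (phi w).1.
have gphi w : good (phi w) by have [] := ext w _ g0.
have phi_lt w w' : ltd w w' -> (phi w).2 (tau w').
  move=> /andP[/prefixP[s ->] ws].
  have [_ _ _] := ext s _ (gphi w); rewrite -foldl_cat; apply.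
  by apply: contraNneq ws => ->; rewrite cats0.
have tau_lt w w' : ltd w w' -> ltd (tau w) (tau w').
  by move=> /phi_lt; have [_ + _] := gphi w; apply.
have tau_le w w' : prefix (tau w) (tau w') -> prefix w w'.
  move=> h; apply: contraT => nww'.
  have [w'w|nw'w] := boolP (prefix w' w); last first.
    have := inc w w' _ g0; rewrite /incomparable (negbTE nww') (negbTE nw'w) => /(_ isT).
    by rewrite -/(tau w) h.
  have : ltd (tau w') (tau w).
    by apply: tau_lt; rewrite /ltd w'w; apply: contraNneq nww' => ->; exact: prefix_refl.
  by move=> /(prefix_ltd_trans h); rewrite ltdxx.
have tau_inj w w' : tau w = tau w' -> w = w'.
  move=> h; apply: dle_size_eq; first by apply: tau_le; rewrite h; exact: prefix_refl.
  by apply/eqP; rewrite eqn_leq !dle_size //; apply: tau_le; rewrite h; exact: prefix_refl.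
have lt_tau w w' : ltd (tau w) (tau w') -> ltd w w'.
  move=> /andP[/tau_le h nww]; rewrite /ltd h /=.
  by apply: contraNneq nww => ->.
have lt_rcons w b : ltd w (rcons w b).
  rewrite /ltd prefix_rcons; apply/eqP => /(congr1 size).
  by rewrite size_rcons => /eqP; rewrite ltn_eqF.
exists (range tau); split.
- split.
    exists r; apply/seteqP; split=> [_ [[w _ <-]] min|_ ->].
      by rewrite -(min r) //; [exists [::]|case: (ext w _ g0)].
    split; first by exists [::].
    move=> _ [w _ <-] h; have /tau_le : prefix (tau w) (tau [::]) by [].
    by rewrite prefixs0 => /eqP ->.
  move=> _ [w _ <-]; exists (tau (rcons w false)), (tau (rcons w true)); split.
    by move=> /tau_inj/rcons_inj[].
  have succ b : immediate_successors (range tau) (tau w) (tau (rcons w b)).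
    split; first by split; [exists (rcons w b)|exact/ltdP/tau_lt].
    move=> _ [[w' _ <-] /ltdP/lt_tau/ltdP/dlt_size ww'] /tau_le w'b.
    congr tau; apply: dle_size_eq => //; apply/eqP.
    by rewrite eqn_leq dle_size // size_rcons.
  apply/seteqP; split=> [_ [[[w' _ <-] /ltdP/lt_tau]]|_ [->|->]]; try exact: succ.
  (* The node of [rcons w b] lies above [tau w] and below the given successor, so minimality
     identifies the two. *)
  move=> /andP[/prefixP[[|b s] ->]]; first by rewrite cats0 eqxx.
  rewrite -cat_rcons => _ min.
  have : tau (rcons w b) = tau (rcons w b ++ s).
    apply: min; last first.
      by have [_ _ + _] := ext s _ (gphi (rcons w b)); rewrite -foldl_cat.
    by split; [exists (rcons w b)|exact/ltdP/tau_lt].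
  by move=> <-; case: b {min}; [right|left].
- split; first by exists r, [::].
  move=> _ [w _ <-]; exists (tau (rcons w false)), (tau (rcons w true)).
  split; try exact: tau_lt; [by exists (rcons w false)|by exists (rcons w true)|].
  by apply: inc => //; rewrite /incomparable -!cats1 !prefix_catr //= !andbF.
- move=> _ [w _ <-]; apply/P0P.
  case: w => [|b w] //; apply/Q0P; apply: (phi_lt [::]).
  by rewrite /ltd prefix0s.
- move=> c sc cT; case/lastP: c sc cT => [|c [t m]] sc cT.
    apply: D_sub _ DP0 => _ [[w _ <-] _].
    case: w => [|b w] //; apply/Q0P; apply: (phi_lt [::]).
    by rewrite /ltd prefix0s.
  have [w _ wt] : range tau t.
    by apply: cT; rewrite map_rcons mem_rcons inE eqxx.
  have [_ _ Dw] := gphi w.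
  apply: (D_sub _ (Dw _ sc _)).
    move=> _ [[w' _ <-] cw']; apply/phi_lt/lt_tau; rewrite wt; apply: cw'.
    by rewrite map_rcons mem_rcons inE eqxx.
  move=> s; rewrite -/(tau w) wt map_rcons mem_rcons inE => /predU1P[->|sc'].
    exact: prefix_refl.
  by apply/ltdW; move: sc; rewrite map_rcons => /sorted_rcons_ltd; apply.
Qed.

End fusion.

Lemma sorted_rcons_trans (T : eqType) (r : rel T) (s : seq T) x :
  transitive r -> sorted r s -> {in s, forall y, r y x} -> sorted r (rcons s x).
Proof.
move=> tr ss sx; rewrite -cats1 (sorted_pairwise tr) pairwise_cat allrel1r /=.
by rewrite -(sorted_pairwise tr) ss !andbT; apply/allP.
Qed.

(** * A Nash-Williams dichotomy for chains *)

Section nash_williams.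
Variable F : seq dyadic -> Prop.

Let accept (a : seq dyadic) (P : set dyadic) : Prop :=
  forall e, incr e -> (forall i, P (e i)) -> exists n, F (a ++ mkseq e n).

Let reject a P := forall Q, perfect Q -> Q `<=` P -> ~ accept a Q.

Let accept_sub a P Q : Q `<=` P -> accept a P -> accept a Q.
Proof. by move=> QP aP e ie eQ; apply: aP => // i; exact/QP/eQ. Qed.

Let fst_unit (a : seq dyadic) : [seq p.1 | p <- [seq (s, tt) | s <- a]] = a.
Proof. by rewrite -map_comp map_id. Qed.

Let ufusion (D : seq dyadic -> set dyadic -> Prop) P :
  (forall c P Q, Q `<=` P -> D c P -> D c Q) ->
  (forall c P, perfect P -> exists Q, [/\ perfect Q, Q `<=` P & D c Q]) ->
  perfect P -> exists T, [/\ perfect T, T `<=` P &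
    forall c, sorted ltd c -> {in c, forall s, T s} -> D c (above T c)].
Proof.
move=> Dsub Ddense pP.
have [||T [_ pT TP DT]] := @fusion unit (fun c => D (map fst c)) _ _ P pP.
- by move=> c; exact: Dsub.
- by move=> c; exact: Ddense.
exists T; split=> // c; have := DT [seq (s, tt) | s <- c].
by rewrite fst_unit.
Qed.

(* Combinatorial forcing, after Galvin and Prikry: a first fusion makes every
   finite chain accepted or rejected, a second one makes all one-point
   extensions of rejected chains rejected. *)
Lemma nash_williams P : perfect P -> exists Q, [/\ perfect Q, Q `<=` P &
  (forall c, sorted ltd c -> {in c, forall s, Q s} -> ~ F c) \/
  (forall e, incr e -> (forall i, Q (e i)) -> exists n, F (mkseq e n))].
Proof.
move=> pP.
have [|a Q pQ|T [pT TP dT]] :=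
  @ufusion (fun a Q => accept a Q \/ reject a Q) P _ _ pP.
- move=> a Q S SQ [aQ|rQ]; first by left; exact: accept_sub aQ.
  by right=> U pU US; apply: rQ => //; exact: subset_trans SQ.
- have [[S [pS SQ aS]]|nS] :=
    pselect (exists S, [/\ perfect S, S `<=` Q & accept a S]).
    by exists S; split=> //; left.
  by exists Q; split=> //; right=> S pS SQ aS; apply: nS; exists S.
have aboveT0 : above T [::] = T by apply/seteqP; split=> [u []|u Tu].
have [aT|rT] := dT [::] isT (fun _ => ltac:(done)).
  by exists T; split=> //; right; move: aT; rewrite aboveT0.
pose rej a := reject a (above T a).
have [|a Q pQ|T' [pT' T'T rT']] := @ufusion (fun a Q => sorted ltd a ->
  {in a, forall s, T s} -> rej a -> forall u, Q u -> above T a u -> rej (rcons a u))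
  T _ _ pT.
- by move=> a Q S SQ h sa aT ra u /SQ; exact: h.
- have [[sa [aT ra]]|n] :=
    pselect (sorted ltd a /\ {in a, forall s, T s} /\ rej a); last first.
    by exists Q; split=> // sa aT ra; case: n.
  have [S [pS SQ [Sr|Sr]]] :=
    perfect_split [set u | above T a u -> rej (rcons a u)] pQ.
    by exists S; split=> // _ _ _ u /Sr.
  have Sa u : S u -> above T a u by move=> /Sr/not_implyP[].
  (* If no point of [S] gives a rejected extension, every chain of [S] is accepted after its first
     point; then [S] accepts [a], which was rejected. *)
  case: (ra S pS Sa) => e ie eS.
  have /not_implyP[[Te0 ae0] nrej] := Sr _ (eS 0%N).
  have se : sorted ltd (rcons a (e 0%N)) by apply: sorted_rcons_trans => //; exact: ltd_trans.
  have [s|acc|//] := dT _ se.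
    by rewrite mem_rcons inE => /predU1P[->|/aT].
  have [i|i|n Fn] := acc (fun i => e i.+1); first exact: ie.
    have ei j : ltd (e 0%N) (e j.+1) by elim: j => // j; move/ltd_trans; apply.
    split; first by have [] := Sa _ (eS i.+1).
    move=> s; rewrite mem_rcons inE => /predU1P[->//|sa'].
    by apply: ltd_trans (ei i); exact: ae0.
  exists n.+1; move: Fn; rewrite cat_rcons /mkseq /=.
  by rewrite (iotaDl 1 0) -map_comp.
exists T'; split=> //; first exact: subset_trans TP.
left=> a; have rejP : sorted ltd a -> {in a, forall s, T' s} -> rej a.
  elim/last_ind: a => [|a u IH] sa aT'; first by [].
  have sa' : sorted ltd a by move: sa; rewrite -cats1 => /cat_sorted2[].
  have aT'' : {in a, forall s, T' s}.
    by move=> s sa2; apply: aT'; rewrite mem_rcons inE sa2 orbT.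
  have T'u : T' u by apply: aT'; rewrite mem_rcons inE eqxx.
  apply: (rT' a) => //; [by move=> s /aT''/T'T|exact: IH| |].
    by split=> // s; exact: sorted_rcons_ltd.
  by split; [exact: T'T|move=> s; exact: sorted_rcons_ltd].
(* A rejected chain is not in [F]: otherwise the empty continuation, [n = 0], would make it
   accepted. *)
move=> sa aT' Fa; apply: (rejP sa aT' (above T a)) => //.
  by apply: perfect_above => // s /aT'/T'T.
by move=> e _ _; exists 0%N; rewrite cats0.
Qed.

End nash_williams.

(** * The dual ball *)

Section hahn_banach.
Context {R : realType} {X : lmodType R}.

Definition sublinear (q : X -> R) : Prop :=
  (forall y z, q (y + z) <= q y + q z) /\
  (forall t y, 0 < t -> q (t *: y) <= t * q y).

Lemma sublinear0 q : sublinear q -> q 0 = 0.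
Proof.
move=> [_ qZ]; have := qZ 2 0 ltac:(lra); have := qZ 2^-1 0 ltac:(lra).
by rewrite !scaler0; lra.
Qed.

Lemma sublinear_opp q y : sublinear q -> - q (- y) <= q y.
Proof.
by move=> sq; have := sublinear0 sq; have [+ _] := sq => /(_ y (- y)); rewrite subrr; lra.
Qed.

Lemma sublinear_scale q t y : sublinear q -> 0 <= t -> q (t *: y) = t * q y.
Proof.
move=> sq; rewrite le_eqVlt => /predU1P[<-|t0].
  by rewrite scale0r mul0r sublinear0.
have [_ qZ] := sq; apply/eqP; rewrite eq_le qZ //=.
have := qZ t^-1 (t *: y); rewrite invr_gt0 scalerA mulVf ?gt_eqF // scale1r.
by move=> /(_ t0); rewrite mulrC ler_pdivlMr // mulrC.
Qed.

(* The largest sublinear functional [r <= q] such that [r (- y) <= - q y]. *)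
Definition deflate (q : X -> R) (y z : X) : R :=
  inf [set q (z + t *: y) - t * q y | t in [set t | 0 <= t]].

Section deflate.
Variables (q : X -> R) (y : X).
Hypothesis sq : sublinear q.

Lemma deflate_le z t : 0 <= t -> deflate q y z <= q (z + t *: y) - t * q y.
Proof.
move=> t0; apply: ge_inf; last by exists t.
exists (- q (- z)) => _ [s s0 <-].
have [/(_ (z + s *: y) (- z)) + _] := sq.
by rewrite addrAC subrr add0r sublinear_scale //; lra.
Qed.

Lemma le_deflate z v :
  (forall t, 0 <= t -> v <= q (z + t *: y) - t * q y) -> v <= deflate q y z.
Proof.
move=> h; apply: lb_le_inf; first by exists (q (z + 0 *: y) - 0 * q y), 0 => /=.
by move=> _ [t t0 <-]; apply: h.
Qed.

Lemma deflate_ub z : deflate q y z <= q z.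
Proof. by have := @deflate_le z 0 (lexx 0); rewrite scale0r mul0r addr0 subr0. Qed.

Lemma deflate_opp : deflate q y (- y) <= - q y.
Proof.
have := @deflate_le (- y) 1 ler01.
by rewrite scale1r addNr sublinear0 // mul1r sub0r.
Qed.

Lemma sublinear_deflate : sublinear (deflate q y).
Proof.
split=> [z w|t z t0].
  rewrite -lerBlDr; apply: le_deflate => t t0.
  rewrite lerBlDr -lerBlDl; apply: le_deflate => s s0.
  have := @deflate_le (z + w) (t + s) (addr_ge0 t0 s0).
  have [/(_ (z + t *: y) (w + s *: y)) + _] := sq.
  by rewrite addrACA -scalerDl; lra.
rewrite -ler_pdivrMl //; apply: le_deflate => s s0.
rewrite ler_pdivrMl //; apply: le_trans (deflate_le _ (mulr_ge0 (ltW t0) s0)) _.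
by rewrite -scalerA -scalerDr sublinear_scale ?(ltW t0) // mulrBr !mulrA.
Qed.

End deflate.

(** Zorn's lemma. Along a totally ordered family the pointwise infimum is finite, every member being
    at least [- p (- y)] at [y], and it is again sublinear. *)
Lemma minimal_sublinear p : sublinear p -> exists q,
  [/\ sublinear q, forall y, q y <= p y &
    forall r, sublinear r -> (forall y, r y <= q y) -> r = q].
Proof.
move=> sp; pose T := {q | sublinear q /\ forall y, q y <= p y}.
pose le (q r : T) := `[< forall y, sval r y <= sval q y >].
have [||||[q [sq qp]] qmin] := @Zorn T le.
- by move=> q; apply/asboolP.
- by move=> q r s /asboolP rq /asboolP sr; apply/asboolP => y; exact: le_trans (rq y).
- move=> [q hq] [r hr] /asboolP rq /asboolP qr; apply: eq_exist.
  by apply/funext => y; apply/le_anti; rewrite (rq y) (qr y).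
- move=> A totA; have [[a0 Aa0]|A0] := pselect (A !=set0); last first.
    by exists (exist _ p (conj sp (fun=> lexx _))) => a Aa; case: A0; exists a.
  pose r y := inf [set sval a y | a in A].
  have r_le a y : A a -> r y <= sval a y.
    move=> Aa; apply: ge_inf; last by exists a.
    exists (- p (- y)) => _ [b Ab <-]; have [sb bp] := svalP b.
    by have := sublinear_opp y sb; have := bp (- y); lra.
  have le_r v y : (forall a, A a -> v <= sval a y) -> v <= r y.
    by move=> h; apply: lb_le_inf => [|_ [a Aa <-]]; [exists (sval a0 y), a0|exact: h].
  have sr : sublinear r.
    split=> [y z|t y t0].
      rewrite -lerBlDr; apply: (le_r) => a Aa; rewrite lerBlDr -lerBlDl.
      apply: le_r => b Ab; rewrite lerBlDl.
      have [ab|ab] := totA _ _ Aa Ab.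
        have [[/(_ y z) bD _] _] := svalP b; move/asboolP: ab => /(_ y).
        by have := r_le _ (y + z) Ab; lra.
      have [[/(_ y z) bD _] _] := svalP a; move/asboolP: ab => /(_ z).
      by have := r_le _ (y + z) Aa; lra.
    rewrite -ler_pdivrMl //; apply: (le_r) => a Aa; rewrite ler_pdivrMl //.
    by apply: le_trans (r_le _ _ Aa) _; have [[_ aZ] _] := svalP a; exact: aZ.
  have rp y : r y <= p y by apply: le_trans (r_le _ y Aa0) _; case: (svalP a0).
  by exists (exist _ r (conj sr rp)) => a Aa; apply/asboolP => y; exact: r_le.
exists q; split=> // r sr rq.
have rp y : r y <= p y by exact: le_trans (qp y).
by have /(congr1 sval) := qmin (exist _ r (conj sr rp)) ltac:(exact/asboolP).
Qed.

(** Minimality forces [deflate q y = q] for every [y], so [q] is odd; an odd subadditive functional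
    is additive. *)
Lemma minimal_sublinear_linear q : sublinear q ->
  (forall r, sublinear r -> (forall y, r y <= q y) -> r = q) ->
  forall a y z, q (a *: y + z) = a * q y + q z.
Proof.
move=> sq qmin.
have qN y : q (- y) = - q y.
  have := deflate_opp y sq; have := sublinear_opp y sq.
  rewrite (qmin _ (sublinear_deflate y sq) (deflate_ub y sq)); lra.
have qD y z : q (y + z) = q y + q z.
  have [qD _] := sq; apply/le_anti; rewrite qD /=.
  by have := qD (y + z) (- z); rewrite addrK qN; lra.
move=> a y z; rewrite qD; congr (_ + _).
have [a0|/ltW a0] := leP 0 a; first exact: sublinear_scale.
by apply: oppr_inj; rewrite -qN -scaleNr -mulNr sublinear_scale // oppr_ge0.
Qed.

End hahn_banach.

Section dual_ball.
Context {R : realType} {X : normedModType R}.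

Definition dual_ball (f : X -> R) : Prop :=
  (forall a y z, f (a *: y + z) = a * f y + f z) /\ forall y, `|f y| <= `|y|.

(** Hahn-Banach at one vector: a minimal sublinear functional below the norm deflated at [- y] is
    linear, and at [y] it is at most minus the norm of [y]; its opposite norms [y]. *)
Lemma norming_functional (y : X) : exists2 f, dual_ball f & f y = `|y|.
Proof.
have sn : sublinear (fun y : X => `|y|).
  by split=> [u v|t u t0]; [exact: ler_normD|rewrite normrZ gtr0_norm].
have [q [sq qn qmin]] := minimal_sublinear (sublinear_deflate (- y) sn).
have ql := minimal_sublinear_linear sq qmin.
have q0 := sublinear0 sq.
have qN u : q (- u) = - q u by have := ql (-1) u 0; rewrite addr0 scaleN1r q0; lra.
have qle u : q u <= `|u| by apply: le_trans (qn u) (deflate_ub _ sn _).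
have qb u : `|q u| <= `|u|.
  by rewrite ler_norml qle andbT lerNl -qN -[leRHS]normrN qle.
exists (fun u => - q u).
  by split=> [a u v|u]; [rewrite ql; lra|rewrite normrN].
have := qle (- y); rewrite qN normrN => h; apply/le_anti; rewrite h /=.
have := le_trans (qn (- - y)) (deflate_opp (- y) sn).
by rewrite opprK normrN; lra.
Qed.

Variable f : X -> R.
Hypothesis fb : dual_ball f.

Lemma dual_ball0 : f 0 = 0.
Proof. by apply/normr0_eq0/le_anti; rewrite normr_ge0 andbT -[leRHS](@normr0 _ X) fb.2. Qed.

Lemma dual_ballZ a y : f (a *: y) = a * f y.
Proof. by have := fb.1 a y 0; rewrite !addr0 dual_ball0 addr0. Qed.

Lemma dual_ballD y z : f (y + z) = f y + f z.
Proof. by have := fb.1 1 y z; rewrite scale1r mul1r. Qed.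

Lemma dual_ball_sum (I : Type) (r : seq I) (P : pred I) (F : I -> X) :
  f (\sum_(i <- r | P i) F i) = \sum_(i <- r | P i) f (F i).
Proof. by apply: big_morph; [exact: dual_ballD|exact: dual_ball0]. Qed.

Lemma dual_ball_le y : f y <= `|y|.
Proof. exact: le_trans (ler_norm _) (fb.2 y). Qed.

Lemma dual_ball_opp : dual_ball (fun y => - f y).
Proof. by split=> [a y z|y]; [rewrite fb.1; lra|rewrite normrN fb.2]. Qed.

Lemma dual_ball_linear : {g : {linear X -> R^o} | continuous g & g =1 f}.
Proof.
have lin : linear (f : X -> R^o) by move=> a y z; rewrite fb.1.
pose g : {linear X -> R^o} := HB.pack (f : X -> R^o) (GRing.isLinear.Build _ _ _ _ _ lin).
exists g => //; apply: bounded_linear_continuous; apply/linear_boundedP.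
apply: filterS (nbhs_pinfty_ge (num_real 1)) => r r1 y.
by apply: le_trans (fb.2 y) _; rewrite ler_peMl.
Qed.

End dual_ball.

(** * Limits along ultrafilters and weak-star compactness *)

Section ultralimits.
Context {R : realType}.

Lemma ultra_cvg (U : set_system nat) (u : nat -> R) (M : R) : UltraFilter U ->
  (forall n, `|u n| <= M) -> exists l : R, u n @[n --> U] --> l.
Proof.
move=> UU uM; have Ui : U (u @^-1` `[- M, M]).
  by apply: filterS filterT => n _ /=; rewrite in_itv /= -ler_norml.
have [l [_ lU]] := @segment_compact R (- M) M (fmap u U) _ Ui.
exists l => B lB; have [//|nB] := in_ultra_setVsetC (u @^-1` B) UU.
by have [z [nz Bz]] := lU (~` B) B nB lB.
Qed.

Lemma ultrafilter_infty : exists2 U : set_system nat, UltraFilter U & U --> \oo.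
Proof. by have [U [UU oU]] := ultraFilterLemma eventually_filter; exists U. Qed.

End ultralimits.

Section weak_star.
Context {R : realType} {X : normedModType R}.

(** Banach-Alaoglu along an ultrafilter: each [f p y] is bounded by the norm of [y], hence
    converges, and the pointwise limit inherits linearity and the bound. *)
Lemma dual_ball_compact (U : set_system nat) (f : nat -> X -> R) : UltraFilter U ->
  (forall p, dual_ball (f p)) ->
  exists2 g, dual_ball g & forall y, f p y @[p --> U] --> g y.
Proof.
move=> UU fb.
have lim y : exists l : R, f p y @[p --> U] --> l.
  by apply: (ultra_cvg UU) => p; exact: (fb p).2.
have [g gP] := choice lim.
exists g => //; split=> [a y z|y].
  apply: (@cvg_unique R _ (fmap (fun p => f p (a *: y + z)) U)) => //=.
  under eq_fun do rewrite (fb _).1.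
  by apply: cvgD => //; apply: cvgMr.
apply: (ler_cvg_to (cvg_norm (gP y)) (@cvg_cst _ `|y| _ U _)).
by apply: filterS filterT => p _; exact: (fb p).2.
Qed.

End weak_star.

(** * Basic sequences *)

Section basic_sequences.
Context {R : realType} {X : completeNormedModType R}.

Lemma sum_scalerBl (v : nat -> X) (a b : nat -> R) n :
  \sum_(0 <= i < n) (a i - b i) *: v i =
  \sum_(0 <= i < n) a i *: v i - \sum_(0 <= i < n) b i *: v i.
Proof. by under eq_bigr do rewrite scalerBl; rewrite big_split sumrN. Qed.

(** Grunblum's condition for basic sequences, with basis constant 2. *)
Definition basis_const2 (u : nat -> X) : Prop := forall (a : nat -> R) m n, (m <= n)%N ->
  `|\sum_(0 <= i < m) a i *: u i| <= 2 * `|\sum_(0 <= i < n) a i *: u i|.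

Variable u : nat -> X.
Hypotheses (u1 : forall n, `|u n| = 1) (ub : basis_const2 u).

(** A term is the difference of two consecutive partial sums, each at most twice the whole sum in
    norm; hence 4. *)
Lemma basis_const2_coef a i n : (i < n)%N -> `|a i| <= 4 * `|\sum_(0 <= i < n) a i *: u i|.
Proof.
move=> ltin; have := ub a (ltnW ltin); have := ub a ltin.
rewrite big_nat_recr //=; set S := \sum_(0 <= j < i) _; set N := `|\sum_(0 <= j < n) _|.
rewrite -[`|a i|]mulr1 -(u1 i) -normrZ.
by have := ler_normB (S + a i *: u i) S; rewrite addrAC subrr add0r; lra.
Qed.

Lemma basis_const2_expansion_unique a b y : expansion u a y -> expansion u b y -> a = b.
Proof.
move=> ay yb; apply/funext => i; apply/eqP; rewrite -subr_eq0; apply/eqP.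
have d0 : `|series (fun i => a i *: u i) n - series (fun i => b i *: u i) n|
    @[n --> \oo] --> (0 : R).
  by rewrite -(@normr0 _ X) -(subrr y); apply: cvg_norm; exact: cvgB.
apply/normr0_eq0/le_anti; rewrite normr_ge0 andbT -(mulr0 4).
apply: (ler_cvg_to (@cvg_cst _ _ nat \oo _) (cvgMr d0)).
near=> n; rewrite /series /= -sum_scalerBl.
apply: (@basis_const2_coef (fun i => a i - b i)); near: n; exact: nbhs_infty_gt.
Unshelve. all: by end_near. Qed.

(** Finite combinations [b k] within [1/(k+1)] of [y] have bounded coefficients; the limits of these
    along an ultrafilter are the coefficients of [y]. *)
Lemma basis_const2_expansion_exists y : closed_span u y -> exists a, expansion u a y.
Proof.
move=> yspan.
have approx k : exists b : nat -> R, exists N, `|y - \sum_(0 <= i < N) b i *: u i| < k.+1%:R^-1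
    /\ forall i, (N <= i)%N -> b i = 0.
  have [z [[n [b ->]] zb]] := yspan _ (nbhsx_ballx y k.+1%:R^-1 ltac:(by rewrite invr_gt0)).
  exists (fun i => if (i < n)%N then b i else 0), n; split=> [|i]; last first.
    by rewrite leqNgt => /negbTE ->.
  move: zb; rewrite -ball_normE /ball_ /=; congr (`|_ - _| < _).
  by rewrite big_mkord; apply: eq_bigr => i _; rewrite ltn_ord.
have [b /choice[N bN]] := choice approx.
have bN_far k n : (N k <= n)%N ->
    \sum_(0 <= i < n) b k i *: u i = \sum_(0 <= i < N k) b k i *: u i.
  move=> kn; rewrite (big_cat_nat _ kn) //= [X in _ + X]big1_seq ?addr0 // => i.
  by rewrite mem_index_iota => /andP[_ /andP[Ni _]]; rewrite (bN k).2 // scale0r.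
have inv1 k : k.+1%:R^-1 <= 1 :> R by rewrite invf_le1 // ler1n.
have [U UU Uoo] := ultrafilter_infty.
have lim i : exists l : R, b k i @[k --> U] --> l.
  apply: (@ultra_cvg _ _ _ (4 * (`|y| + 1)) UU) => k.
  have := @basis_const2_coef (b k) i (maxn i.+1 (N k)) (leq_maxl _ _).
  rewrite bN_far ?leq_maxr //; have [yk _] := bN k.
  set z := \sum_(0 <= j < N k) _ in yk *.
  have := ler_normB y (y - z); rewrite opprB addrCA subrr addr0.
  have := inv1 k; move: yk.
  by move: (k.+1%:R^-1) `|y - z| `|z| `|y| `|b k i| => *; lra.
have [a aP] := choice lim.
(* The partial sums of [b k - b l] are at most twice the distance of the two approximants; passing
   to the limit in [l] along [U] replaces [b l] by [a]. *)
have far n k : `|\sum_(0 <= i < n) (b k i - a i) *: u i| <= 2 * k.+1%:R^-1.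
  have bnd l : `|\sum_(0 <= i < n) (b k i - b l i) *: u i| <=
      2 * (k.+1%:R^-1 + l.+1%:R^-1).
    have := ub (fun i => b k i - b l i) (leq_maxl n (maxn (N k) (N l))).
    move/le_trans; apply; rewrite ler_pM2l //.
    rewrite sum_scalerBl !bN_far ?leq_max ?leqnn ?orbT //.
    have [yk _] := bN k; have [yl _] := bN l.
    set zk := \sum_(0 <= j < N k) _ in yk *; set zl := \sum_(0 <= j < N l) _ in yl *.
    have := ler_normB (y - zl) (y - zk); rewrite opprB [_ + (zk - y)]addrC addrA subrK.
    move: yk yl; move: (k.+1%:R^-1) (l.+1%:R^-1) `|y - zk| `|y - zl| `|zk - zl| => *; lra.
  apply: (@ler_cvg_to _ U _ R _ _ _ _ _ _ (filterS (fun l _ => bnd l) filterT)).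
    apply: cvg_norm; apply: cvg_big; first exact: add_continuous.
    by move=> i _; apply: cvgZ; [apply: cvgB; [exact: cvg_cst|exact: aP]|exact: cvg_cst].
  have -> : 2 * k.+1%:R^-1 = 2 * (k.+1%:R^-1 + 0) :> R by rewrite addr0.
  apply: cvgMr; apply: cvgD; first exact: cvg_cst.
  exact: cvg_trans (cvg_app _ Uoo) cvg_harmonic.
exists a; apply/cvgrPdist_lt => e e0.
(* The 3 adds the distance from [y] to the approximant, once [1/(k+1)], and the bound [far], twice
   that. *)
have [k ke] : exists k : nat, 3 * k.+1%:R^-1 < e.
  have [k _ /(_ k (leqnn k))] := near_infty_natSinv_lt (PosNum (divr_gt0 e0 (ltr0Sn R 2))).
  by move=> /= ke; exists k; rewrite mulrC -ltr_pdivlMr.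
apply: filterS (nbhs_infty_ge (N k)) => n /= Nn; apply: le_lt_trans ke.
have := far n k; rewrite sum_scalerBl bN_far //; have [yk _] := bN k; rewrite /series /=.
set zk := \sum_(0 <= j < N k) _ in yk *; set s := \sum_(0 <= j < n) _ => zs.
have := ler_normD (y - zk) (zk - s); rewrite addrA subrK.
move: yk zs; move: (k.+1%:R^-1) `|y - zk| `|zk - s| `|y - s| => *; lra.
Qed.

Lemma basis_const2_schauder_basic : schauder_basic u.
Proof.
move=> y /basis_const2_expansion_exists[a ay]; exists a; split=> // b yb.
exact: basis_const2_expansion_unique ay yb.
Qed.

End basic_sequences.

Lemma incr_lt e i j : incr e -> (i < j)%N -> ltd (e i) (e j).
Proof. by move=> ie; apply: (homo_ltn ltd_trans ie). Qed.

Lemma incr_range_chain e : incr e -> is_chain [set: dyadic] (range e).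
Proof.
move=> ie.
have e_inj i j : e i = e j -> i = j.
  move=> eij; have [ij|ij|//] := ltgtP i j; have := incr_lt ie ij;
  by rewrite eij ltdxx.
split=> //.
  rewrite (eq_finite_set (inj_card_eq _)); first exact: infinite_nat.
  by move=> i j _ _; exact: e_inj.
move=> _ _ [i _ <-] [j _ <-]; have [ij|ij|->] := ltgtP i j.
- by left; apply/ltdW/incr_lt.
- by right; apply/ltdW/incr_lt.
- by left; exact: prefix_refl.
Qed.

Lemma chain_enum_range e : incr e -> chain_enum (range e) = e.
Proof.
move=> ie; apply: (@enumerates_inj (range e)); first exact: chain_enumP (incr_range_chain ie).
by split=> // i; apply/ltdP.
Qed.

Lemma chain_enum_incr T beta : is_chain T beta ->
  incr (chain_enum beta) /\ forall i, T (chain_enum beta i).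
Proof.
move=> cb; have [einc eb] := chain_enumP cb; have [bT _ _] := cb.
split=> i; first exact/ltdP/einc.
by have : range (chain_enum beta) (chain_enum beta i) by [exists i]; rewrite eb => /bT.
Qed.

Lemma cvg_sum_nat (R : realType) (V : normedModType R) (U : set_system nat)
    (F : nat -> nat -> V) (l : nat -> V) n : Filter U ->
  (forall i, (0 <= i < n)%N -> F k i @[k --> U] --> l i) ->
  \sum_(0 <= i < n) F k i @[k --> U] --> \sum_(0 <= i < n) l i.
Proof.
move=> FU; elim: n => [|n IH] Fl.
  by rewrite big_nil; under eq_fun do rewrite big_nil; exact: cvg_cst.
rewrite big_nat_recr //=; under eq_fun do rewrite big_nat_recr //=.
apply: cvgD; last by apply: Fl; rewrite leqnn.
by apply: IH => i ilt; apply: Fl; move: ilt => /andP[_ ilt]; apply: ltnW.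
Qed.

(** * Mazur's construction of basic sequences, along chains *)

Section trees.
Context {R : realType} {X : completeNormedModType R}.
Variable x : dyadic -> X.
Hypothesis x1 : forall s, `|x s| = 1.
Hypothesis x_wnull : forall beta : set dyadic,
  is_chain [set: dyadic] beta -> weakly_null (along x beta).

Lemma chain_null e f : incr e -> dual_ball f -> f (x (e n)) @[n --> \oo] --> (0 : R).
Proof.
move=> ie fb; have [g gc gf] := dual_ball_linear fb.
have := x_wnull (incr_range_chain ie) gc; rewrite /along chain_enum_range //.
by under eq_fun do rewrite gf.
Qed.

(** A weak-star limit of the [f p] would be at least [eps] in absolute value on the whole chain,
    against weak nullity. *)
Lemma no_uniformly_large_functionals e (eps : R) (f : nat -> X -> R) :
  incr e -> 0 < eps -> (forall p, dual_ball (f p)) ->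
  ~ forall p j, (j < p)%N -> eps <= `|f p (x (e j))|.
Proof.
move=> ie eps0 fb large; have [U UU Uoo] := ultrafilter_infty.
have [g gb fg] := dual_ball_compact UU fb.
have glarge j : eps <= `|g (x (e j))|.
  apply: (ler_cvg_to (@cvg_cst _ eps _ U _) (cvg_norm (fg _))).
  apply: Uoo; apply: filterS (nbhs_infty_gt j) => p; exact: large.
have /cvgr0Pnorm_lt/(_ _ eps0)[n _ /(_ n (leqnn n)) /=] := chain_null ie gb.
by rewrite ltNge glarge.
Qed.

Definition comb (c : seq dyadic) (a : nat -> R) : X :=
  \sum_(0 <= i < size c) a i *: x (nth [::] c i).

(** A quantitative form of linear independence of the vectors [x s] for [s] in [c]. *)
Definition coefs_bounded (c : seq dyadic) : Prop :=
  exists C, forall a i, (i < size c)%N -> `|a i| <= C * `|comb c a|.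

Lemma comb_rcons c u a : comb (rcons c u) a = comb c a + a (size c) *: x u.
Proof.
rewrite /comb size_rcons big_nat_recr //= nth_rcons ltnn eqxx.
by congr (_ + _); apply: eq_big_nat => i /andP[_ ic]; rewrite nth_rcons ic.
Qed.

Lemma combZ c k a : comb c (fun i => k * a i) = k *: comb c a.
Proof. by rewrite /comb scaler_sumr; apply: eq_bigr => i _; rewrite scalerA. Qed.

(** Once normalized, the combinations converge along an ultrafilter to a vector [comb c b] of norm
    1. A functional norming this limit tends to 0 on [x (e n)], so it tends to 1 on the perturbed
    vectors, whose norms would be below [1 / rho]. *)
Lemma no_norm_drop e c (rho : R) (a : nat -> nat -> R) (l : nat -> R) :
  incr e -> 1 < rho -> coefs_bounded c ->
  ~ forall n, rho * `|comb c (a n) + l n *: x (e n)| < `|comb c (a n)|.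
Proof.
move=> ie rho1 [C cC].
wlog a1 : a l / forall n, `|comb c (a n)| = 1.
  move=> wl drop; pose k n := `|comb c (a n)|^-1.
  have N0 n : 0 < `|comb c (a n)|.
    by apply: le_lt_trans (drop n); rewrite mulr_ge0 // (le_trans _ (ltW rho1)).
  have k0 n : 0 < k n by rewrite invr_gt0.
  apply: (wl (fun n i => k n * a n i) (fun n => k n * l n)) => n; rewrite combZ.
    by rewrite normrZ gtr0_norm // mulVf // gt_eqF.
  by rewrite -scalerA -scalerDr !normrZ !gtr0_norm // mulrCA ltr_pM2l.
move=> drop; have [U UU Uoo] := ultrafilter_infty.
have lim i : exists b : R, (i < size c)%N -> a n i @[n --> U] --> b.
  have [ic|ic] := ltnP i (size c); last by exists 0.
  have [n|b ab] := @ultra_cvg _ U (fun n => a n i) C UU; last by exists b.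
  by rewrite -[C]mulr1 -(a1 n); exact: cC.
have [b ab] := choice lim.
(* The perturbed vector has norm below 1 and [comb c (a n)] has norm 1; hence the bound 2 on
   [l n]. *)
have [m lm] : exists m : R, l n @[n --> U] --> m.
  apply: (@ultra_cvg _ _ _ 2 UU) => n; have := drop n; rewrite a1.
  have := ler_normB (comb c (a n) + l n *: x (e n)) (comb c (a n)).
  rewrite addrAC subrr add0r normrZ x1 mulr1 a1.
  by move: `|l n| `|_ + _| => p q ? ?; nra.
have ab' i : (0 <= i < size c)%N -> a n i @[n --> U] --> b i.
  by move=> /andP[_]; exact: ab.
have cvg_comb : comb c (a n) @[n --> U] --> comb c b.
  by apply: cvg_sum_nat => i ic; apply: cvgZ; [exact: ab'|exact: cvg_cst].
have cb1 : `|comb c b| = 1.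
  apply: (@cvg_unique R _ (fmap (fun n => `|comb c (a n)|) U)) => //=.
    exact: cvg_norm.
  by under eq_fun do rewrite a1; exact: cvg_cst.
have [f fb fcb] := norming_functional (comb c b).
have cvg_f : rho * f (comb c (a n) + l n *: x (e n)) @[n --> U] --> rho * 1.
  have -> : rho * 1 = rho * (f (comb c b) + m * 0) by rewrite mulr0 addr0 fcb cb1.
  apply: cvgMr; under eq_fun do rewrite dual_ballD // dual_ballZ //.
  apply: cvgD; last by apply: cvgM => //; exact: cvg_trans (cvg_app _ Uoo) (chain_null ie fb).
  rewrite /comb dual_ball_sum //; under eq_fun do rewrite dual_ball_sum //.
  apply: cvg_sum_nat => i ic; rewrite dual_ballZ //; under eq_fun do rewrite dual_ballZ //.
  by apply: cvgM; [exact: ab'|exact: cvg_cst].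
suff : rho * 1 <= 1 by rewrite mulr1 leNgt rho1.
apply: (ler_cvg_to cvg_f (@cvg_cst _ (1 : R) _ U _)).
apply: filterS filterT => n _; have := drop n; rewrite a1 => dn.
apply: le_trans (ltW dn); rewrite ler_pM2l ?(lt_trans _ rho1) //.
exact: dual_ball_le.
Qed.

(* Only [weight n / weight n.+1 > 1] and the boundedness of the products of
   these ratios matter. *)
Definition weight (n : nat) : R := 1 + 2^-1 ^+ n.

Lemma weight_bounds n : 1 <= weight n <= 2.
Proof.
rewrite lerDl exprn_ge0 ?invr_ge0 //= (_ : 2 = 1 + 1) // lerD2l.
by rewrite exprn_ile1 ?invr_ge0 // invf_le1 // ler1n.
Qed.

Lemma weight_gt0 n : 0 < weight n.
Proof. by apply: lt_le_trans ltr01 _; have /andP[] := weight_bounds n. Qed.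

Definition basic_step (c : seq dyadic) (u : dyadic) : Prop := forall a l,
  weight (size c).+1 * `|comb c a| <= weight (size c) * `|comb c a + l *: x u|.

Lemma coefs_bounded_rcons c u :
  coefs_bounded c -> basic_step c u -> coefs_bounded (rcons c u).
Proof.
move=> [C cC] cu; exists (2 * `|C| + 3) => a i; rewrite size_rcons ltnS comb_rcons.
have le2 : `|comb c a| <= 2 * `|comb c a + a (size c) *: x u|.
  have [w1 _] := andP (weight_bounds (size c).+1).
  have [_ w2] := andP (weight_bounds (size c)).
  apply: le_trans (_ : _ <= weight (size c).+1 * _) _; first exact: ler_peMl.
  by apply: le_trans (cu _ _) _; exact: ler_wpM2r.
rewrite leq_eqVlt => /predU1P[->|ic]; last first.
  apply: le_trans (cC a i ic) _; apply: le_trans (ler_wpM2r (normr_ge0 _) (ler_norm C)) _.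
  apply: le_trans (ler_wpM2l (normr_ge0 C) le2) _.
  by rewrite mulrA [_ * 2]mulrC ler_wpM2r // lerDl.
have := ler_normB (comb c a + a (size c) *: x u) (comb c a).
rewrite addrAC subrr add0r normrZ x1 mulr1 => /le_trans; apply.
apply: le_trans (_ : _ <= 3 * `|comb c a + a (size c) *: x u|) _.
  by move: le2; move: `|comb c a| `|_ + _| => p q ?; lra.
by rewrite ler_wpM2r // lerDr mulr_ge0.
Qed.

(** Otherwise a perfect set consists of points violating [basic_step c], and a chain in it
    contradicts [no_norm_drop], with [rho] the ratio of two consecutive weights. *)
Lemma basic_step_dense c P : perfect P -> coefs_bounded c ->
  exists Q, [/\ perfect Q, Q `<=` P & forall u, Q u -> basic_step c u].
Proof.
move=> pP cb.
have [Q [pQ QP [Qs|Qn]]] := perfect_split (basic_step c) pP; first by exists Q.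
have [e [ie eQ]] := perfect_chain pQ.
have bad n : exists al : (nat -> R) * R, weight (size c) / weight (size c).+1 *
    `|comb c al.1 + al.2 *: x (e n)| < `|comb c al.1|.
  apply: contrapT => h; apply: (Qn _ (eQ n)) => a l; rewrite leNgt; apply/negP => al.
  by apply: h; exists (a, l); rewrite mulrAC ltr_pdivrMr ?weight_gt0 // [ltRHS]mulrC.
have [al alP] := choice bad.
exfalso; apply: (no_norm_drop ie _ cb alP).
rewrite ltr_pdivlMr ?weight_gt0 // mul1r ltrD2l exprS gtr_pMl ?exprn_gt0 ?invr_gt0 //.
by rewrite invf_lt1 ?ltr1n.
Qed.

Lemma basic_refinement P : perfect P -> exists Q, [/\ perfect Q, Q `<=` P &
  forall e, incr e -> (forall i, Q (e i)) -> basis_const2 (fun i => x (e i))].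
Proof.
(* Fusion treats every chain, so [coefs_bounded] is a premise inside [D]; along a chain of [Q] it is
   recovered by induction, since basic steps preserve it. *)
move=> pP; pose D (c : seq (dyadic * unit)) Q :=
  coefs_bounded (map fst c) -> forall u, Q u -> basic_step (map fst c) u.
have [||Q [_ pQ QP DQ]] := @fusion _ D _ _ P pP.
- by move=> c S S' SS h cb u /SS; exact: h.
- move=> c S pS; have [cb|ncb] := pselect (coefs_bounded (map fst c)); last first.
    by exists S; split=> // cb; case: ncb.
  by have [S' [pS' SS hS']] := basic_step_dense pS cb; exists S'; split=> // _.
exists Q; split=> // e ie eQ.
pose c n := [seq e i | i <- iota 0 n].
have ce n a : comb (c n) a = \sum_(0 <= i < n) a i *: x (e i).
  rewrite /comb size_map size_iota; apply: eq_big_nat => i /andP[_ ilt].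
  by rewrite (nth_map 0%N) ?size_iota // nth_iota // add0n.
have cS n : c n.+1 = rcons (c n) (e n) by rewrite /c -addn1 iotaD map_cat cats1.
have step n : coefs_bounded (c n) -> basic_step (c n) (e n).
  have fstK : [seq p.1 | p <- [seq (s, tt) | s <- c n]] = c n by rewrite -map_comp map_id.
  have := DQ [seq (s, tt) | s <- c n]; rewrite /D fstK => h cb; apply: h => //.
  - rewrite /c; apply: (homo_sorted _ _ (iota_ltn_sorted 0 n)) => i j; exact: incr_lt.
  - by move=> s /mapP[i _ ->].
  - split=> // s /mapP[i]; rewrite mem_iota => /andP[_ ilt] ->.
    exact: incr_lt.
have cb n : coefs_bounded (c n).
  elim: n => [|n IH]; first by exists 0 => a i.
  by rewrite cS; apply: coefs_bounded_rcons => //; exact: step.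
move=> a m n mn.
(* The losses telescope to the factor [weight m / weight n], at most 2 because weights lie between 1
   and 2. *)
have wS : weight n * `|\sum_(0 <= i < m) a i *: x (e i)| <=
    weight m * `|\sum_(0 <= i < n) a i *: x (e i)|.
  elim: n mn => [|n IH]; first by rewrite leqn0 => /eqP ->.
  rewrite leq_eqVlt => /predU1P[->//|]; rewrite ltnS => /IH {}IH.
  have := step n (cb n) a (a n); rewrite size_map size_iota ce.
  rewrite big_nat_recr //=; set N := `|_ + _|; move: IH.
  set M := `|\sum_(0 <= i < m) _|; set L := `|\sum_(0 <= i < n) _| => IH sn.
  rewrite -(ler_pM2l (weight_gt0 n)).
  rewrite [leLHS]mulrCA (le_trans (ler_wpM2l (ltW (weight_gt0 n.+1)) IH)) //.
  by rewrite [leLHS]mulrCA [leRHS]mulrCA ler_wpM2l // ltW // weight_gt0.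
have [w1 _] := andP (weight_bounds n); have [_ w2] := andP (weight_bounds m).
apply: le_trans (_ : _ <= weight n * _) _; first exact: ler_peMl.
by apply: le_trans wS _; exact: ler_wpM2r.
Qed.

End trees.

(** * The c_0 alternative *)

Section c0_dichotomy.
Context {R : realType} {X : completeNormedModType R}.
Variable x : dyadic -> X.
Hypothesis x1 : forall s, `|x s| = 1.
Hypothesis x_wnull : forall beta : set dyadic,
  is_chain [set: dyadic] beta -> weakly_null (along x beta).

(** A witness against the upper [c_0] estimate with constant [K]. *)
Definition bad (K : R) (c : seq dyadic) : Prop :=
  exists a : nat -> R, (forall i, `|a i| <= 1) /\ K < `|comb x c a|.

Lemma comb_mkseq e n a : comb x (mkseq e n) a = \sum_(0 <= i < n) a i *: x (e i).
Proof.
by rewrite /comb size_mkseq; apply: eq_big_nat => i /andP[_ ilt]; rewrite nth_mkseq.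
Qed.

(** The coefficient bound of a basic sequence gives the lower estimate with constant 4. Dividing by
    the largest coefficient turns the absence of bad segments into the upper estimate with constant
    [K]. *)
Lemma equiv_c0_of_not_bad K e : 0 <= K -> basis_const2 (fun i => x (e i)) ->
  (forall n, ~ bad K (mkseq e n)) -> equiv_c0 (K + 4) (fun i => x (e i)).
Proof.
move=> K0 eb nbad n a; set M := \big[_/_]_(i < n) _.
pose b k := oapp a 0 (insub k : option 'I_n).
have bE (i : 'I_n) : b i = a i by rewrite /b valK.
have -> : \sum_(i < n) a i *: x (e i) = \sum_(0 <= i < n) b i *: x (e i).
  by rewrite big_mkord; apply: eq_bigr => i _; rewrite bE.
have aM i : `|a i| <= M by apply: le_bigmax.
have M0 : 0 <= M by apply: bigmax_ge_id.
split.
  rewrite ler_pdivrMl ?ltr_wpDl //; apply/bigmax_leP; split=> [|i _].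
    by rewrite mulr_ge0 // addr_ge0.
  rewrite -bE; apply: le_trans (basis_const2_coef (fun=> x1 _) eb b (ltn_ord i)) _.
  by rewrite ler_wpM2r // lerDr.
have [M_eq0|M_neq0] := eqVneq M 0.
  rewrite M_eq0 mulr0 big1_seq ?normr0 // => i; rewrite mem_index_iota => /andP[_ /andP[_ ilt]].
  have := aM (Ordinal ilt); rewrite M_eq0 -bE normr_le0 => /eqP /= ->.
  by rewrite scale0r.
have Mgt0 : 0 < M by rewrite lt_def M_neq0.
apply: le_trans (_ : _ <= K * M) _; last by rewrite ler_wpM2r // lerDl.
rewrite leNgt; apply/negP => KM; apply: (nbad n); exists (fun i => M^-1 * b i).
split=> [i|]; last first.
  by rewrite combZ normrZ comb_mkseq gtr0_norm ?invr_gt0 // mulrC ltr_pdivlMr.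
rewrite normrM gtr0_norm ?invr_gt0 // ler_pdivrMl // mulr1 /b.
by case: insubP => [j _ _|_] /=; rewrite ?aM // normr0.
Qed.

(** The length [K] of a chain encodes the threshold: the requirement is that chains above it begin
    with a segment bad for [K]. The last hypothesis rules out the other Nash-Williams
    alternative. *)
Lemma bad_refinement P0 P : perfect P -> P `<=` P0 ->
  (forall K Q, perfect Q -> Q `<=` P0 ->
     exists c, [/\ sorted ltd c, {in c, forall s, Q s} & bad K c]) ->
  exists Q, [/\ perfect Q, Q `<=` P & forall e K, incr e -> (forall i, Q (e i)) ->
    exists n, bad K%:R (mkseq (fun i => e (K + i)%N) n)].
Proof.
move=> pP PP0 bads.
(* Restricting to chains in [P0] makes the requirement dense among all perfect sets: those disjoint
   from [P0] meet it vacuously. *)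
pose D (c : seq (dyadic * unit)) Q := forall e, incr e -> (forall i, Q (e i) /\ P0 (e i)) ->
  exists n, bad (size c)%:R (mkseq e n).
have [||T [_ pT TP DT]] := @fusion _ D _ _ P pP.
- by move=> c S S' SS h e ie eS; apply: h => // i; have [/SS] := eS i.
- move=> c S pS; have [Q [pQ QS [QP0|QnP0]]] := perfect_split P0 pS; last first.
    by exists Q; split=> // e _ /(_ 0%N)[/QnP0].
  have [U [pU UQ [nU|aU]]] := nash_williams (bad (size c)%:R) pQ.
    have [l [sl lU lb]] := bads (size c)%:R U pU (subset_trans UQ QP0).
    by case: (nU l).
  exists U; split=> //; first exact: subset_trans QS.
  by move=> e ie eU; apply: aU => // i; case: (eU i).
exists T; split=> // e K ie eT.
have fstK : [seq p.1 | p <- [seq (s, tt) | s <- mkseq e K]] = mkseq e K.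
  by rewrite -map_comp map_id.
have := DT [seq (s, tt) | s <- mkseq e K]; rewrite fstK /D size_map size_mkseq; apply.
- by apply: (homo_sorted _ _ (iota_ltn_sorted 0 K)) => i j; exact: incr_lt.
- by move=> s /mapP[i _ ->].
- by move=> i; rewrite addnS.
- move=> i; split; last exact/PP0/TP.
  split=> // s /mapP[j]; rewrite mem_iota => /andP[_ jK] ->.
  by apply: incr_lt => //; rewrite ltn_addr.
Qed.

End c0_dichotomy.

(** * Near unconditionality *)

Lemma sorted_le_last (I : seq nat) i : sorted ltn I -> i \in I -> (i <= last 0%N I)%N.
Proof.
case/lastP: I => // I l.
rewrite last_rcons mem_rcons inE -cats1 (sorted_pairwise ltn_trans) pairwise_cat allrel1r.
by move=> /andP[/allP h _] /predU1P[->//|/h/ltnW].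
Qed.

Lemma filter_iota_mem (I : seq nat) m n : sorted ltn I ->
  {in I, forall i, (m <= i < n)%N} -> [seq i <- iota m (n - m) | i \in I] = I.
Proof.
move=> sI mIn; apply: (irr_sorted_eq ltn_trans ltnn) => //.
  by apply: sorted_filter; [exact: ltn_trans|exact: iota_ltn_sorted].
move=> i; rewrite mem_filter mem_iota; case: (boolP (i \in I)) => //= /mIn /andP[mi ilt].
by rewrite mi /= subnKC // (leq_trans mi) // ltnW.
Qed.

Section near_unconditionality.
Context {R : realType} {X : completeNormedModType R}.
Variable x : dyadic -> X.
Hypothesis x1 : forall s, `|x s| = 1.
Hypothesis x_wnull : forall beta : set dyadic,
  is_chain [set: dyadic] beta -> weakly_null (along x beta).

(* In a marked chain, [Some true] asks a functional to be nonnegative,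
   [Some false] asks it to be small, [None] asks nothing. *)
Notation marked := (seq (dyadic * option bool)).

Fixpoint obeys (f : X -> R) (i : nat) (c : marked) : Prop :=
  if c isn't (s, m) :: c' then True else
  match m with
  | Some true => 0 <= f (x s)
  | Some false => `|f (x s)| <= 2^-1 ^+ i
  | None => True
  end /\ obeys f i.+1 c'.

(* The target of the sum is coded by the number of [None] marks, so that it is
   determined by the chain that the fusion lemma is applied to. *)
Definition feasible (f : X -> R) (c : marked) : Prop :=
  [/\ dual_ball f, obeys f 0 c &
    (count (fun p => p.2 == None) c)%:R <
      2 * \sum_(p <- c | p.2 == Some true) f (x p.1)].

Definition positive (G : seq dyadic) : marked := [seq (g, Some true) | g <- G].

(** Feasibility first appears at the full length of [G]; so, for a given [c], at most one initial
    segment of a chain is critical. *)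
Definition critical (c : marked) (G : seq dyadic) : Prop :=
  (exists f, feasible f (c ++ positive G)) /\
  forall m f, (m < size G)%N -> ~ feasible f (c ++ positive (take m G)).

(** Elton's step: a point [u] skipped between [c] and [G] can be given a small value without losing
    feasibility. *)
Definition good (c : marked) (u : dyadic) (G : seq dyadic) : Prop :=
  critical c G -> G != [::] -> exists f, feasible f (c ++ (u, Some false) :: positive G).

Lemma obeys_cat f i c d : obeys f i (c ++ d) <-> obeys f i c /\ obeys f (i + size c) d.
Proof.
elim: c i => [|[s m] c IH] i /=; first by rewrite addn0; tauto.
by rewrite addnS -addSn; have := IH i.+1; tauto.
Qed.

Lemma obeys_nth f i c d j : obeys f i c -> (j < size c)%N ->
  obeys f (i + j) [:: nth d c j].
Proof.
elim: c i j => // -[s m] c IH i [|j] /= [sm oc] jc; first by rewrite addn0.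
by rewrite -addSnnS; exact: IH.
Qed.

Lemma obeys_positive f i G :
  obeys f i (positive G) <-> {in G, forall s, 0 <= f (x s)}.
Proof.
elim: G i => [|g G IH] i //=; split=> [[g0 /IH oG] s|oG].
  by rewrite inE => /predU1P[->|/oG].
by split; [apply: oG; rewrite inE eqxx|apply/IH => s sG; apply: oG; rewrite inE sG orbT].
Qed.

Lemma feasible_unmarked f l G :
  feasible f ([seq (s, None) | s <- l] ++ positive G) <->
  [/\ dual_ball f, {in G, forall s, 0 <= f (x s)} &
    (size l)%:R < 2 * \sum_(s <- G) f (x s)].
Proof.
have none i : obeys f i [seq (s, None) | s <- l] by elim: l i => //= s l IH i.
rewrite /feasible count_cat !count_map count_predT (eq_count (a2 := pred0)) //.
rewrite count_pred0 addn0 big_cat !big_map /= big_pred0_eq add0r.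
split=> -[fb ob lt_sum]; split=> //.
  by have [_ /obeys_positive] := (obeys_cat _ _ _ _).1 ob.
by apply/obeys_cat; split=> //; apply/obeys_positive.
Qed.

Lemma feasible_insert f c u G :
  feasible f (c ++ (u, Some false) :: positive G) <->
  feasible f (c ++ positive G) /\ `|f (x u)| <= 2^-1 ^+ size c.
Proof.
rewrite /feasible !count_cat !big_cat /= big_cons /= add0n; split.
  move=> [fb /obeys_cat[oc /= [fu oG]] lt_sum]; split=> //; split=> //.
  by apply/obeys_cat; split=> //; move/obeys_positive: oG => /obeys_positive.
move=> [[fb /obeys_cat[oc oG] lt_sum] fu]; split=> //.
by apply/obeys_cat; do 2!split=> //; move/obeys_positive: oG => /obeys_positive.
Qed.

(** Otherwise every chain of some perfect set begins with a failure of goodness. Take a chain [e]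
    and apply this to [e j], [e p], [e (p+1)], ... for all [j < p]. The critical piece of the tail
    does not depend on [j], so one feasible functional serves every [j], and it is large at each
    [e j], as a small value would give goodness. Letting [p] grow contradicts weak nullity. *)
Lemma good_dense c P : perfect P -> exists Q, [/\ perfect Q, Q `<=` P &
  forall u G, path ltd u G -> Q u -> {in G, forall s, Q s} -> good c u G].
Proof.
move=> pP.
have [Q [pQ QP [goodQ|badQ]]] :=
  nash_williams (fun l => if l is u :: G then ~ good c u G else False) pP.
  exists Q; split=> // u G uG Qu GQ; apply: contrapT => ngood.
  by apply: (goodQ (u :: G)) => // s; rewrite inE => /predU1P[->|/GQ].
have [e [ie eQ]] := perfect_chain pQ; exfalso.
pose tail p n := mkseq (fun i => e (p + i)%N) n.
have take_tail p m n : (m <= n)%N -> take m (tail p n) = tail p m.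
  by move=> mn; rewrite /tail /mkseq -map_take take_iota (minn_idPl mn).
have witness p j : (j < p)%N -> exists n, ~ good c (e j) (tail p n).
  move=> jp; have [||[|n]] := badQ (fun i => if i is i'.+1 then e (p + i')%N else e j).
  - by case=> [|i] /=; [rewrite addn0; exact: incr_lt|rewrite addnS].
  - by case.
  - by [].
  by rewrite /mkseq /= (iotaDl 1 0) -map_comp => ngood; exists n.
have large p : exists f, dual_ball f /\
    forall j, (j < p)%N -> 2^-1 ^+ size c <= `|f (x (e j))|.
  case: p => [|p].
    by have [f fb _] := norming_functional (x [::]); exists f.
  have [n0 /not_implyP[[[f ff] min0] /not_implyP[_ _]]] := witness p.+1 0%N isT.
  exists f; split=> [|j jp]; first by case: ff.
  have [n /not_implyP[[[g fg] min] /not_implyP[_ nofeas]]] := witness p.+1 j jp.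
  (* Both tails are critical for the same [c]; a shorter one would be a feasible proper initial
     segment of the other. *)
  have nn0 : n = n0.
    have [lt_n|lt_n|//] := ltgtP n n0.
      case: (min0 n g); rewrite ?size_mkseq // take_tail //; exact: ltnW.
    case: (min n0 f); rewrite ?size_mkseq // take_tail //; exact: ltnW.
  rewrite leNgt; apply/negP => /ltW small; apply: nofeas; exists f.
  by apply/feasible_insert; rewrite nn0.
have [f fP] := choice large.
apply: (no_uniformly_large_functionals x_wnull ie _ (fun p => (fP p).1) (fun p => (fP p).2)).
by rewrite exprn_gt0 // invr_gt0.
Qed.

Lemma good_refinement P : perfect P -> exists T, [/\ perfect T, T `<=` P &
  forall c u G, sorted ltd (map fst c ++ u :: G) ->
    {in map fst c ++ u :: G, forall s, T s} -> good c u G].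
Proof.
move=> pP.
pose D (c : marked) Q := forall u G, path ltd u G -> Q u -> {in G, forall s, Q s} -> good c u G.
have [||T [_ pT TP DT]] := @fusion (option bool) D _ _ P pP.
- by move=> c S S' SS h u G uG /SS uS GS; apply: h => // s /GS/SS.
- by move=> c S pS; have [Q [pQ QS goodQ]] := good_dense c pS; exists Q.
exists T; split=> // c u G; rewrite (sorted_pairwise ltd_trans) pairwise_cat.
move=> /and3P[/allrelP cu sc sG] cT.
have above_c s : s \in u :: G -> above T (map fst c) s.
  move=> sG'; split; first by apply: cT; rewrite mem_cat sG' orbT.
  by move=> r rc; exact: cu.
apply: (DT c).
- by rewrite (sorted_pairwise ltd_trans).
- by move=> s sc'; apply: cT; rewrite mem_cat sc'.
- by move: sG; rewrite -(sorted_pairwise ltd_trans).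
- by apply: above_c; rewrite inE eqxx.
- by move=> s sG'; apply: above_c; rewrite inE sG' orbT.
Qed.

Section one_chain.
Variables (T : set dyadic) (e : nat -> dyadic) (K : nat).
Hypothesis goodT : forall c u G, sorted ltd (map fst c ++ u :: G) ->
    {in map fst c ++ u :: G, forall s, T s} -> good c u G.
Hypotheses (ie : incr e) (eT : forall i, T (e i)).

Let unmarked : marked := [seq (e i, None) | i <- iota 0 K].

(** Positions are scanned upwards from [K], preserving criticality. A position in [I] just passes
    from the positive tail to the marked chain; any other is inserted by goodness, and since
    insertion only adds a constraint, shorter tails stay infeasible. *)
Lemma critical_feasible (I : seq nat) : sorted ltn I -> I != [::] ->
  {in I, forall i, (K <= i)%N} -> critical unmarked (map e I) ->
  exists f, [/\ dual_ball f, {in I, forall i, 0 <= f (x (e i))},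
    forall i, (K <= i < last 0%N I)%N -> i \notin I -> `|f (x (e i))| <= 2^-1 ^+ i &
    K%:R < 2 * \sum_(i <- I) f (x (e i))].
Proof.
move=> sI I0 KI critI; pose n := (last 0%N I).+1.
pose mark i := if (i < K)%N then None else Some (i \in I).
pose c k : marked := [seq (e i, mark i) | i <- iota 0 k].
pose J k := [seq i <- iota k (n - k) | i \in I].
have lastI : last 0%N I \in I by case: I I0 {sI KI critI n mark c J} => //= a I _; exact: mem_last.
have ltIn i : i \in I -> (i < n)%N by exact: sorted_le_last.
have JK : J K = I by apply: filter_iota_mem => // i iI; rewrite KI // ltIn.
have Kn : (K <= n)%N by apply: leq_trans (ltnW (ltIn _ lastI)); exact: KI.
have cS k : c k.+1 = rcons (c k) (e k, mark k) by rewrite /c -addn1 iotaD map_cat cats1.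
have JS k : (k < n)%N -> J k = if k \in I then k :: J k.+1 else J k.+1.
  by move=> kn; rewrite /J -[(n - k)%N]prednK ?subn_gt0 //= -subnS.
have critical_step k : (K <= k <= n)%N -> critical (c k) (map e (J k)).
  move=> /andP[]; elim: k => [|k IH].
    rewrite leqn0 => /eqP K0 _; have cu : c 0%N = unmarked by rewrite /unmarked K0.
    by rewrite cu -K0 JK.
  rewrite leq_eqVlt => /predU1P[<- _|].
    rewrite JK; have -> // : c K = unmarked.
    by apply/eq_in_map => i; rewrite mem_iota /mark => /andP[_ ->].
  rewrite ltnS => Kk kn; have {}IH := IH Kk (ltnW kn).
  move: IH; rewrite cS (JS _ kn) /mark ltnNge Kk /=.
  case: ifP => [kI|/negbT kI] crit.
    move: crit => [[f ff] min]; split; first by exists f; rewrite cat_rcons.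
    by move=> m g mlt; rewrite cat_rcons; exact: (min m.+1 g).
  (* A skipped [k] is below the last element of [I], so the remaining tail is nonempty, as goodness
     demands. *)
  have J0 : J k.+1 != [::].
    apply/eqP => J0; have : last 0%N I \in J k.+1; last by rewrite J0.
    rewrite mem_filter lastI mem_iota subnKC // (ltIn _ lastI) andbT /=.
    rewrite ltn_neqAle -ltnS kn andbT; by apply: contraNneq kI => ->.
  have gd : good (c k) (e k) (map e (J k.+1)).
    have cat_e : map fst (c k) ++ e k :: map e (J k.+1) =
        map e (iota 0 k ++ k :: J k.+1) by rewrite -map_comp map_cat.
    apply: goodT; rewrite cat_e; last by move=> s /mapP[i _ ->].
    apply: (homo_sorted _ _ (subseq_sorted ltn_trans _ (iota_ltn_sorted 0 n))).
      by move=> i j; exact: incr_lt.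
    rewrite -(subnKC (ltnW kn)) iotaD add0n -[(n - k)%N]prednK ?subn_gt0 //= -subnS.
    by apply: cat_subseq => //; rewrite /= eqxx filter_subseq.
  have [|f ff] := gd crit; first by case: (J k.+1) J0.
  split; first by exists f; rewrite cat_rcons.
  move=> m g mlt; rewrite cat_rcons => /feasible_insert[fg _].
  by case: crit => _ /(_ m g mlt).
have le_iota : iota 0 n = iota 0 K ++ iota K (n - K) by rewrite -iotaD subnKC.
have JE : [seq i <- iota 0 n | mark i == Some true] = I.
  rewrite le_iota filter_cat -[RHS]JK -[RHS]cat0s; congr (_ ++ _).
    rewrite -(filter_pred0 (iota 0 K)); apply: eq_in_filter => i.
    by rewrite mem_iota /mark => /andP[_ ->].
  apply: eq_in_filter => i; rewrite mem_iota => /andP[Ki _].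
  by rewrite /mark ltnNge Ki; case: (i \in I).
have count_None : count (fun i => mark i == None) (iota 0 n) = K.
  have K1 : count (fun i => mark i == None) (iota 0 K) = K.
    rewrite -[RHS](size_iota 0 K); apply/eqP; rewrite -all_count; apply/allP => i.
    by rewrite mem_iota /mark => /andP[_ ->].
  rewrite le_iota count_cat K1 -[RHS]addn0; congr (_ + _)%N.
  rewrite -(count_pred0 (iota K (n - K))); apply: eq_in_count => i.
  by rewrite mem_iota => /andP[Ki _]; rewrite /mark ltnNge Ki.
have [|[f] + _] := critical_step n; first by rewrite Kn leqnn.
have -> : J n = [::] by rewrite /J subnn.
rewrite cats0 => -[fb obeys_n]; rewrite count_map count_None big_map -big_filter JE => sum_I.
have obeys_i i : (i < n)%N -> obeys f i [:: (e i, mark i)].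
  move=> ilt; have := obeys_nth ([::], None) obeys_n (_ : (i < size (c n))%N).
  by rewrite size_map size_iota (nth_map 0%N) ?size_iota // nth_iota // add0n; apply.
exists f; split=> // [i iI|i /andP[Ki ilt] iI].
  by have := obeys_i i (ltIn _ iI); rewrite /= /mark ltnNge KI //= iI => -[].
by have := obeys_i i (ltnW ilt); rewrite /= /mark ltnNge Ki (negbTE iI) => -[].
Qed.

End one_chain.

End near_unconditionality.

(** * Vanishing of the coefficients, and the dichotomy *)

Section main.
Context {R : realType} {X : completeNormedModType R}.
Variable x : dyadic -> X.
Hypothesis x1 : forall s, `|x s| = 1.
Hypothesis x_wnull : forall beta : set dyadic,
  is_chain [set: dyadic] beta -> weakly_null (along x beta).

Lemma geometric_sum_le m n : \sum_(m <= i < n) (2^-1 : R) ^+ i <= 2.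
Proof.
have sum0 k : \sum_(0 <= i < k) (2^-1 : R) ^+ i = 2 - 2 * 2^-1 ^+ k.
  elim: k => [|k IH]; first by rewrite big_nil expr0; lra.
  by rewrite big_nat_recr //= IH exprS; lra.
have e0 k : 0 <= (2^-1 : R) ^+ k by rewrite exprn_ge0 // invr_ge0.
have [nm|mn] := leqP n m; first by rewrite big_geq.
have := sum0 n; rewrite (big_cat_nat _ (ltnW mn)) //= sum0.
have : (2^-1 : R) ^+ m <= 1 by rewrite exprn_ile1 // ?invr_ge0 // invf_le1 // ler1n.
by have := e0 n; move: (2^-1 ^+ m) (2^-1 ^+ n) => p q ? ? ?; lra.
Qed.

(** For a functional norming the combination, the absolute values along [c] add up to more than [K];
    its positive part or that of its opposite carries at least half. *)
Lemma half_sum_of_bad K c : bad x K c ->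
  exists2 f : X -> R, dual_ball f & K < 2 * \sum_(s <- c | 0 <= f (x s)) f (x s).
Proof.
move=> [a [a1 Ka]]; have [f fb fa] := norming_functional (comb x c a).
pose S (g : X -> R) := \sum_(s <- c | 0 <= g (x s)) g (x s).
have Kle : K < S f + S (fun y => - f y).
  apply: lt_le_trans Ka _; rewrite -fa /comb dual_ball_sum //.
  rewrite /S [X in _ <= X + _]big_mkcond [X in _ <= _ + X]big_mkcond /=.
  rewrite -big_split /= [leRHS](big_nth [::]).
  apply: ler_sum => i _; rewrite dual_ballZ //.
  apply: le_trans (ler_norm _) _; rewrite normrM.
  apply: le_trans (ler_wpM2r (normr_ge0 _) (a1 i)) _; rewrite mul1r oppr_ge0.
  have [h|h] := leP 0 (f (x (nth [::] c i))).
    by rewrite ger0_norm // lerDl; case: ifP => // f0; rewrite oppr_ge0.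
  by rewrite ltr0_norm // add0r (ltW h).
have [le_S|lt_S] := leP (S (fun y => - f y)) (S f).
  by exists f => //; rewrite -/(S f); lra.
exists (fun y => - f y); first exact: dual_ball_opp.
by rewrite -/(S (fun y => - f y)); lra.
Qed.

(** A bad segment among the positions of large coefficients yields, through [critical_feasible], a
    functional [h] nonnegative on a set [I] of such positions and summably small in the gaps. On the
    block of the series from [K] to the end of [I], [h] exceeds [delta * K / 2 - 4 * M], yet
    boundedness keeps it at most [2 * M]. *)
Lemma coefs_vanish (T : set dyadic) e (lambda : nat -> R) (M delta : R) :
  (forall e K, incr e -> (forall i, T (e i)) ->
    exists n, bad x K%:R (mkseq (fun i => e (K + i)%N) n)) ->
  (forall c u G, sorted ltd (map fst c ++ u :: G) ->
    {in map fst c ++ u :: G, forall s, T s} -> good x c u G) ->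
  incr e -> (forall i, T (e i)) ->
  (forall n, `|\sum_(0 <= i < n) lambda i *: x (e i)| <= M) -> 0 < delta ->
  ~ forall N, exists2 n, (N <= n)%N & delta <= lambda n.
Proof.
move=> badT goodT ie eT boundM delta0 often.
have M0 : 0 <= M by exact: le_trans (boundM 0%N).
have next N : exists n, (N <= n)%N /\ delta <= lambda n.
  by have [n Nn dn] := often N; exists n.
have [nx nxP] := choice next.
pose a i := iter i (fun k => nx k.+1) (nx 0%N).
have aS i : (a i < a i.+1)%N by case: (nxP (a i).+1).
have a_ge i : (i <= a i)%N by elim: i => // i IH; exact: leq_ltn_trans (aS i).
have a_large i : delta <= lambda (a i) by case: i => [|i]; exact: (nxP _).2.
have a_mono : {homo a : i j / (i < j)%N} by exact: homo_ltn ltn_trans aS.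
(* The final estimates give [delta * K < 12 * M], which this choice excludes. The same [K] is the
   badness threshold and the number of initial positions left unmarked. *)
pose K := Num.bound (12 * M / delta).
have KM : 12 * M < delta * K%:R.
  by have := unstable.ltr_bound (12 * M / delta); rewrite ltr_pdivrMr // [ltRHS]mulrC.
have iea : incr (fun i => e (a i)) by move=> i; exact: incr_lt.
have [n nbad] := badT _ K iea (fun=> eT _).
have [f fb fsum] := half_sum_of_bad nbad.
pose J := [seq i <- [seq a (K + i)%N | i <- iota 0 n] | 0 <= f (x (e i))].
have sJ : sorted ltn J.
  apply: sorted_filter; first exact: ltn_trans.
  by apply: (homo_sorted _ _ (iota_ltn_sorted 0 n)) => i j ij; apply: a_mono; rewrite ltn_add2l.
have JP i : i \in J -> (K <= i)%N /\ delta <= lambda i.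
  rewrite mem_filter => /andP[_ /mapP[j _ ->]]; split=> //.
  exact: leq_trans (leq_addr _ _) (a_ge _).
pose c : seq (dyadic * option bool) := [seq (e i, None) | i <- iota 0 K].
have feasE g I : feasible x g (c ++ positive (map e I)) <-> [/\ dual_ball g,
    {in I, forall i, 0 <= g (x (e i))} & K%:R < 2 * \sum_(i <- I) g (x (e i))].
  have -> : c = [seq (s, None) | s <- map e (iota 0 K)] by rewrite -map_comp.
  split=> [/feasible_unmarked|[gb gpos gsum]].
    rewrite size_map size_iota big_map => -[gb gpos gsum]; split=> // i iI.
    exact/gpos/map_f.
  apply/feasible_unmarked; rewrite size_map size_iota big_map; split=> //.
  by move=> _ /mapP[i iI ->]; exact: gpos.
have ex_m : exists m, `[< exists g, feasible x g (c ++ positive (map e (take m J))) >].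
  exists (size J); apply/asboolP; exists f; rewrite take_size; apply/feasE; split=> //.
    by move=> i; rewrite mem_filter => /andP[].
  by move: fsum; rewrite /J big_filter big_map /mkseq big_map.
(* The least feasible length makes [take m J] critical. *)
case: (ex_minnP ex_m) => m /asboolP[g gfeas] mmin.
pose I := take m J.
have IJ i : i \in I -> i \in J by exact: mem_take.
have sI : sorted ltn I by exact: take_sorted.
have I0 : I != [::].
  apply/eqP => I0; move: gfeas; rewrite -/I I0 => /feasE[_ _].
  by rewrite big_nil mulr0 ltrn0.
have critI : critical x c (map e I).
  split=> [|k h]; first by exists g.
  rewrite size_map size_take_min leq_min => /andP[km _]; rewrite -map_take take_takel ?(ltnW km) //.
  move=> hfeas; have /mmin : `[< exists g, feasible x g (c ++ positive (map e (take k J))) >].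
    by apply/asboolP; exists h.
  by rewrite leqNgt km.
have [|h [hb hpos hsmall hsum]] := critical_feasible goodT ie eT sI I0 _ critI.
  by move=> i /IJ/JP[].
pose N := (last 0%N I).+1.
have lambda_le i : `|lambda i| <= 2 * M.
  have -> : `|lambda i| = `|lambda i *: x (e i)| by rewrite normrZ x1 mulr1.
  have := ler_normB (\sum_(0 <= j < i.+1) lambda j *: x (e j))
    (\sum_(0 <= j < i) lambda j *: x (e j)).
  rewrite {1}big_nat_recr //= addrAC subrr add0r => /le_trans; apply.
  by have := boundM i; have := boundM i.+1; lra.
have I_iota : [seq i <- iota K (N - K) | i \in I] = I.
  apply: filter_iota_mem => // i iI; rewrite ltnS sorted_le_last // andbT.
  by have [] := JP _ (IJ _ iI).
have lastI : last 0%N I \in I by case: (I) I0 => //= b l _; exact: mem_last.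
(* On [I] the coefficient is at least [delta] and [h] is nonnegative; in the gaps the product is at
   most [2 * M] times a term of the geometric series. *)
have term i : (K <= i < N)%N ->
    delta * (if i \in I then h (x (e i)) else 0) - 2 * M * 2^-1 ^+ i <= lambda i * h (x (e i)).
  move=> /andP[Ki iN]; have e0 : 0 <= 2 * M * 2^-1 ^+ i :> R.
    by rewrite !mulr_ge0 // exprn_ge0 // invr_ge0.
  case: ifPn => iI.
    have [_ dl] := JP _ (IJ _ iI); have := ler_wpM2r (hpos _ iI) dl; lra.
  have ilt : (K <= i < last 0%N I)%N.
    by rewrite Ki ltn_neqAle -ltnS iN andbT; apply: contraNneq iI => ->.
  rewrite mulr0 sub0r; have : `|lambda i * h (x (e i))| <= 2 * M * 2^-1 ^+ i.
    by rewrite normrM ler_pM // hsmall.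
  by rewrite ler_norml => /andP[].
have KN : (K <= N)%N by have [/leq_trans h' _] := JP _ (IJ _ lastI); exact: h'.
have upper : \sum_(K <= i < N) lambda i * h (x (e i)) <= 2 * M.
  have := ler_normB (\sum_(0 <= j < N) lambda j *: x (e j)) (\sum_(0 <= j < K) lambda j *: x (e j)).
  rewrite {1}(big_cat_nat _ KN) //= addrAC subrr add0r => normS.
  under eq_bigr do rewrite -(dual_ballZ hb).
  rewrite -(dual_ball_sum hb); apply: le_trans (dual_ball_le hb _) _.
  by apply: le_trans normS _; have := boundM N; have := boundM K; lra.
have : \sum_(K <= i < N)
    (delta * (if i \in I then h (x (e i)) else 0) - 2 * M * 2^-1 ^+ i) <= 2 * M.
  by apply: le_trans upper; rewrite big_nat [leRHS]big_nat; apply: ler_sum.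
rewrite big_split sumrN /= -!mulr_sumr -big_mkcond /index_iota -big_filter I_iota.
have geo : 2 * M * \sum_(i <- iota K (N - K)) 2^-1 ^+ i <= 2 * M * 2.
  by rewrite ler_wpM2l ?mulr_ge0 //; have := geometric_sum_le K N; rewrite /index_iota.
have big : delta * K%:R < delta * (2 * \sum_(i <- I) h (x (e i))) by rewrite ltr_pM2l.
move: geo big KM; rewrite mulrCA.
move: (delta * \sum_(i <- I) h (x (e i))) (delta * K%:R) (2 * M * \sum_(i <- _) _).
by move=> p q r ? ? ? ?; lra.
Qed.

End main.

Theorem theorem6p2 (R : realType) (X : completeNormedModType R)
    (x : dyadic -> X)
    (x_normalized : forall s : dyadic, `|x s| = 1)
    (x_wnull : forall beta : set dyadic,
       is_chain [set: dyadic] beta -> weakly_null (along x beta)) :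
  exists T : set dyadic, is_subtree T /\
    ((forall beta : set dyadic,
        is_chain T beta -> semi_boundedly_complete (along x beta)) \/
     (exists C : R, 0 < C /\
        forall beta : set dyadic, is_chain T beta -> equiv_c0 C (along x beta))).
Proof.
have perfT : perfect [set: dyadic].
  split; first by exists [::].
  move=> t _; exists (rcons t false), (rcons t true).
  split=> //; try by rewrite /ltd prefix_rcons; apply/eqP => /(congr1 size);
    rewrite size_rcons => /eqP; rewrite ltn_eqF.
  by rewrite /incomparable -!cats1 !prefix_catr //= !andbF.
have [P0 [pP0 _ basicP]] := basic_refinement x_normalized x_wnull perfT.
(* A bound [K] valid on some perfect set leads to [c_0]; otherwise every perfect subset of [P0] has
   bad chains for every [K]. *)
have [[K [P [pP PP0 nbad]]]|bads] := pselect (exists K P, [/\ perfect P, P `<=` P0 &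
    forall c, sorted ltd c -> {in c, forall s, P s} -> ~ bad x K c]).
  (* With a trivial requirement, fusion just extracts a subtree from a perfect set. *)
  have [||T [Tsub _ TP _]] := @fusion unit (fun _ _ => True) _ _ P pP => //.
    by move=> _ Q pQ; exists Q; split.
  exists T; split=> //; right; exists (`|K| + 4); split; first by rewrite ltr_wpDl.
  move=> beta /chain_enum_incr[ie eT]; apply: equiv_c0_of_not_bad => //.
    by apply: basicP => // i; exact/PP0/TP.
  move=> n [a [a1 Ka]]; apply: (nbad (mkseq (chain_enum beta) n)).
  - by apply: (homo_sorted _ _ (iota_ltn_sorted 0 n)) => i j; exact: incr_lt.
  - by move=> s /mapP[i _ ->]; exact: TP.
  - by exists a; split=> //; exact: le_lt_trans (ler_norm K) Ka.
have [|P1 [pP1 P10 badP1]] := bad_refinement (x := x) pP0 (subset_refl (A := P0)).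
  move=> K Q pQ QP0; apply: contrapT => noc; apply: bads; exists K, Q.
  by split=> // c sc cQ bc; apply: noc; exists c.
have [P2 [pP2 P21 goodP2]] := good_refinement x_wnull pP1.
have [||T [Tsub _ TP2 _]] := @fusion unit (fun _ _ => True) _ _ P2 pP2 => //.
  by move=> _ Q pQ; exists Q; split.
exists T; split=> //; left => beta /chain_enum_incr[ie eT].
have eP2 i : P2 (chain_enum beta i) by exact: TP2.
have eb : basis_const2 (along x beta) by apply: basicP => // i; exact/P10/P21.
split=> [n||lambda [M Mub]]; first exact: x_normalized.
  by apply: basis_const2_schauder_basic => // n; exact: x_normalized.
have boundM n : `|\sum_(0 <= i < n) lambda i *: x (chain_enum beta i)| <= M.
  by apply: Mub; exists n => //; rewrite big_mkord.
have badP2 e K : incr e -> (forall i, P2 (e i)) ->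
    exists n, bad x K%:R (mkseq (fun i => e (K + i)%N) n).
  by move=> ie' eP2'; apply: badP1 => // i; exact: P21.
apply/cvgr0Pnorm_lt => delta delta0; apply: contrapT => nlim.
have often N : exists2 n, (N <= n)%N & delta <= `|lambda n|.
  apply: contrapT => h; apply: nlim; exists N => // n /= Nn.
  by rewrite ltNge; apply/negP => dn; apply: h; exists n.
(* [coefs_vanish] excludes only positive large coefficients: if those stop from [N] on, it is
   applied again to [- lambda]. *)
apply: (coefs_vanish x_normalized badP2 goodP2 ie eP2 boundM delta0) => N.
apply: contrapT => few.
have boundN n : `|\sum_(0 <= i < n) - lambda i *: x (chain_enum beta i)| <= M.
  by under eq_bigr do rewrite scaleNr; rewrite sumrN normrN.
apply: (coefs_vanish x_normalized badP2 goodP2 ie eP2 boundN delta0) => N'.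
have [n] := often (maxn N N'); rewrite geq_max => /andP[Nn N'n].
rewrite ler_normr => /orP[dn|dn]; first by case: few; exists n.
by exists n.
Qed.
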